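(* For every integer $m\ge0$ and all $\rho,x$, the following identities hold as power series in $t$: (1) $$\sum_{n=0}^\infty\frac{2^n}{n!}H_{n+m}(\rho)H_n(x)t^n=(1-t^2)^{-\frac{m+1}{2}}e^{\rho^2-\frac{(\rho-xt)^2}{1-t^2}}H_m\Big(\frac{\rho-xt}{\sqrt{1-t^2}}\Big).$$ (2) $$\sum_{n=0}^\infty\frac{2^n}{n!}H_{n+m}(\rho)t^n=H_m(\rho-t)\,e^{2\rho t-t^2}.$$ (3) $$\sum_{n=0}^\infty\frac{2^n}{n!}H_{n+m-1}(\rho,1)H_n(x)t^n=(1-t^2)^{-\frac{m+1}{2}}\Big[H_{m-1}\Big(\frac{\rho-xt}{\sqrt{1-t^2}},1\Big)+\sqrt\pi\Big(\mathrm{erfi}(\rho)-\mathrm{erfi}\Big(\frac{\rho-xt}{\sqrt{1-t^2}}\Big)\Big)e^{-\frac{(\rho-xt)^2}{1-t^2}}H_m\Big(\frac{\rho-xt}{\sqrt{1-t^2}}\Big)\Big].$$ (4) $$\sum_{n=0}^\infty\frac{2^n}{n!}H_{n+m-1}(\rho,1)t^n=H_{m-1}(\rho-t,1)+\sqrt\pi\big(\mathrm{erfi}(\rho)-\mathrm{erfi}(\rho-t)\big)e^{-(\rho-t)^2}H_m(\rho-t).$$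
   Context: $H_n(x)$ are the monic Hermite polynomials: $H_{-1}=0$, $H_0=1$, $xH_n(x)=H_{n+1}(x)+\frac n2H_{n-1}(x)$. $H_n(x,c)$ are the associated monic Hermite polynomials: $H_{-1}(x,c)=0$, $H_0(x,c)=1$, $xH_n(x,c)=H_{n+1}(x,c)+\frac{n+c}{2}H_{n-1}(x,c)$ for $n\ge0$; here $c=1$. $\mathrm{erfi}(z)=\frac{2}{\sqrt\pi}\int_0^ze^{s^2}\,ds$. *)

(* Defs.v *)
From Stdlib Require Import Reals ZArith Lra Lia.
From Coquelicot Require Import Coquelicot.

Open Scope C_scope.

(** * Elementary functions of a complex variable *)

Definition Cexp (z : C) : C :=
  ((exp (Re z) * cos (Im z))%R, (exp (Re z) * sin (Im z))%R).

(* Half-angle formula for the principal argument, in (-PI, PI).  It is only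
   meaningful off the cut of nonpositive reals, where the denominator does not
   vanish. *)
Definition Carg (z : C) : R := (2 * atan (Im z / (Cmod z + Re z)))%R.

Definition Clog (z : C) : C := (ln (Cmod z), Carg z).

(* Principal branch, for z off the nonpositive reals. *)
Definition Cpower (z a : C) : C := Cexp (a * Clog z).

Definition Csqrt (z : C) : C := Cpower z (1 / 2).

(* The integral of exp(s^2) from 0 to z, taken along the segment s = u z with
   0 <= u <= 1; the integrand is entire, so the path is immaterial. *)
Definition erfi (z : C) : C :=
  2 / RtoC (sqrt PI) *
  RInt (V := C_R_CompleteNormedModule)
    (fun u : R => z * Cexp ((RtoC u * z) ^ 2)) 0 1.

(** * Monic Hermite polynomials and associated monic Hermite polynomials *)

Fixpoint hermite (n : nat) (x : C) : C :=
  match n with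
  | O => 1
  | S p => match p with
           | O => x
           | S q => x * hermite p x - RtoC (INR p) / 2 * hermite q x
           end
  end.

Fixpoint hermite_assoc_nat (c : C) (n : nat) (x : C) : C :=
  match n with
  | O => 1
  | S p => match p with
           | O => x
           | S q => x * hermite_assoc_nat c p x
                    - (RtoC (INR p) + c) / 2 * hermite_assoc_nat c q x
           end
  end.

(* H_n(x, c) with an integer index, so that the index -1 makes sense. *)
Definition hermite_assoc (c : C) (n : Z) (x : C) : C :=
  match n with
  | Zneg _ => 0
  | _ => hermite_assoc_nat c (Z.to_nat n) x
  end.

Lemma hermite_rec0 (x : C) : x * hermite 0 x = hermite 1 x.
Proof. simpl; ring. Qed.

Lemma hermite_rec (n : nat) (x : C) :
  x * hermite (S n) x
  = hermite (S (S n)) x + RtoC (INR (S n)) / 2 * hermite n x.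
Proof.
change (hermite (S (S n)) x)
  with (x * hermite (S n) x - RtoC (INR (S n)) / 2 * hermite n x).
ring.
Qed.

Lemma hermite_assoc_rec (c : C) (n : Z) (x : C) : (0 <= n)%Z ->
  x * hermite_assoc c n x
  = hermite_assoc c (n + 1) x
    + (RtoC (IZR n) + c) / 2 * hermite_assoc c (n - 1) x.
Proof.
intros Hn; destruct (Z_of_nat_complete n Hn) as [k ->]; clear Hn.
assert (E : forall j : nat,
  hermite_assoc c (Z.of_nat j) x = hermite_assoc_nat c j x).
{ intros j; unfold hermite_assoc; rewrite Nat2Z.id; now destruct j. }
destruct k as [|k].
- simpl; ring.
- replace (Z.of_nat (S k) + 1)%Z with (Z.of_nat (S (S k))) by lia.
  replace (Z.of_nat (S k) - 1)%Z with (Z.of_nat k) by lia.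
  rewrite !E, <- INR_IZR_INZ.
  change (hermite_assoc_nat c (S (S k)) x)
    with (x * hermite_assoc_nat c (S k) x
          - (RtoC (INR (S k)) + c) / 2 * hermite_assoc_nat c k x).
  ring.
Qed.

(** * Power series expansions at the origin *)

(* f(t) = sum_n a_n t^n as power series in t: the series converges to f on
   some disc around 0.  For f analytic at 0 this says exactly that the a_n are
   the Taylor coefficients of f at 0. *)
Definition has_power_series (f : C -> C) (a : nat -> C) : Prop :=
  exists r : R, (0 < r)%R /\
    forall t : C, (Cmod t < r)%R ->
      is_pseries (K := C_AbsRing) (V := C_NormedModule) a t (f t).

(* Main.v *)
Require Import Defs.
From Stdlib Require Import Reals ZArith Lra Lia ClassicalEpsilon.
From Coquelicot Require Import Coquelicot.

Open Scope C_scope.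

(** Write [phi(t) = (1 - t^2)^(-1/2)] and [xi(t) = (rho - x t) phi(t)].  All four
    right-hand sides have the form [phi^(m+1) Phi_m(xi)] (with [phi = 1] and
    [xi = rho - t] in (2) and (4)), where [Phi_m] is one of the two families

      [e^(rho^2 - w^2) H_m(w)],
      [H_(m-1)(w,1) + sqrt pi (erfi rho - erfi w) e^(-w^2) H_m(w)].

    The factors multiplying [H_m] are chosen so that [Phi_m(rho)] is [H_m(rho)],
    respectively [H_(m-1)(rho,1)].  Both families satisfy the Hermite recurrence
    [Phi_(m+2) = w Phi_(m+1) - (m+1)/2 Phi_m], start with [Phi_1 = w Phi_0 + delta]
    for a constant [delta] (0, respectively 1), and have [Phi_0' = -2 Phi_1].  This
    is all that is used about them ([is_hermite_tower]).  It gives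
    [Phi_m' = -2 Phi_(m+1)] for every [m], so (2) and (4) are just Taylor expansions
    of [Phi_m] at [rho], while (1) and (3) generalise Mehler's formula.

    To treat both kinds at once, let [L_0 = 1], [L_1 = x],
    [L_(n+2) = x L_(n+1) - eps (n+1)/2 L_n]: this is [H_n(x)] for [eps = 1] and the
    constant 1 for [eps = 0], [x = 1].  Put
    [S_m(t) = sum 2^n/n! Phi_(n+m)(rho) L_n t^n].  The recurrences turn into

      [(1 - eps t^2) S_(m+2) = (rho - x t) S_(m+1) - (m+1)/2 S_m],
      [(1 - eps t^2) S_1 = (rho - x t) S_0 + delta],
      [S_0' = 2 x S_1 - 2 eps t S_2],

    and the functions [phi^(m+1) Phi_m(xi)] with [phi = (1 - eps t^2)^(-1/2)] satisfy
    the same relations.  Eliminating [S_1] and [S_2], the difference [D] of the two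
    sides for [m = 0] solves a homogeneous scalar equation [D' = a D] with [D(0) = 0].
    One solution of [y' = a y] is [phi e^(-xi^2)], that is, Mehler's kernel up to a
    constant; so [D / (phi e^(-xi^2))] has derivative zero and vanishes
    ([is_Cderive_integrating_factor]).  The first two relations then carry the
    identity from [m = 0] to every [m] ([tower_bilinear_series]).

    The rest is the complex analysis behind this argument.  A power series with
    geometrically bounded coefficients has a complex derivative, obtained term by
    term ([is_Cderive_Cseries]).  The coefficients above are bounded in this way
    because [Phi_n(rho)] and [L_n] grow at most like [A B^n sqrt(n!)]
    ([three_term_growth]), which the factor [1/n!] absorbs.  A function with zero
    derivative along a ray from the origin is constant on it ([Cderive_0_const]).
    Finally [exp], [log] and [erfi], given by real formulas, have the expected
    complex derivatives. *)

(** * Complex arithmetic *)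

Lemma INR_fact_pos (n : nat) : (0 < INR (fact n))%R.
Proof. apply lt_0_INR, lt_O_fact. Qed.

Lemma RtoC_INR_S_fact (n : nat) :
  RtoC (INR (fact (S n))) = RtoC (INR (S n)) * RtoC (INR (fact n)).
Proof. now rewrite <- RtoC_mult, <- mult_INR. Qed.

Lemma RtoC_INR_S_neq_0 (n : nat) : RtoC (INR (S n)) <> 0.
Proof. intros E; apply RtoC_inj in E; revert E; apply not_0_INR; lia. Qed.

Lemma RtoC_INR_fact_neq_0 (n : nat) : RtoC (INR (fact n)) <> 0.
Proof. intros E; apply RtoC_inj in E; revert E; apply INR_fact_neq_0. Qed.

Lemma Cmod_inv_fact (n : nat) : Cmod (/ RtoC (INR (fact n))) = (/ INR (fact n))%R.
Proof.
rewrite <- RtoC_inv, Cmod_R by apply INR_fact_neq_0.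
apply Rabs_right, Rle_ge, Rlt_le, Rinv_0_lt_compat, INR_fact_pos.
Qed.

Lemma RtoC_2_neq_0 : RtoC 2 <> 0.
Proof. intros E; apply RtoC_inj in E; lra. Qed.

Lemma Cmod_Ci : Cmod Ci = 1%R.
Proof.
transitivity (sqrt 1); [unfold Cmod; simpl; f_equal; ring|apply sqrt_1].
Qed.

Lemma Cmod_Re_Im_le (z : C) : (Cmod z <= Rabs (Re z) + Rabs (Im z))%R.
Proof.
assert (Hz : z = RtoC (Re z) + RtoC (Im z) * Ci).
{ destruct z as [a b]; unfold RtoC, Ci, Cplus, Cmult, Re, Im; simpl.
  f_equal; ring. }
rewrite Hz at 1.
eapply Rle_trans; [apply Cmod_triangle|].
rewrite Cmod_mult, !Cmod_R, Cmod_Ci; lra.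
Qed.

Lemma Re_pos_Cmod_pos (z : C) : (0 < Re z)%R -> (0 < Cmod z)%R.
Proof.
intros Hz; apply Rlt_le_trans with (1 := Hz).
eapply Rle_trans; [apply Rle_abs|apply re_le_Cmod].
Qed.

Lemma Cmod_sqr (z : C) : (Cmod z * Cmod z = Re z * Re z + Im z * Im z)%R.
Proof.
unfold Cmod, Re, Im; rewrite sqrt_sqrt; [ring|].
apply Rplus_le_le_0_compat; apply pow2_ge_0.
Qed.

(** * Complex derivatives *)

(** The target is [C] with the uniform structure of its absolute value, not the
    product structure of [R * R]: only then do the product rule over an [AbsRing]
    and the chain rule speak of the same derivative. *)
Definition is_Cderive (f : C -> C) (z l : C) : Prop :=
  @is_derive C_AbsRing (AbsRing_NormedModule C_AbsRing) f z l.

Lemma is_Cderive_eps (f : C -> C) (z l : C) :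
  is_Cderive f z l <->
  forall eps : R, (0 < eps)%R -> exists d : R, (0 < d)%R /\
    forall h : C, (Cmod h < d)%R ->
      (Cmod (f (z + h) - f z - h * l)%C <= eps * Cmod h)%R.
Proof.
split.
- intros [_ H] eps Heps.
  destruct (H z (fun P HP => HP) (mkposreal eps Heps)) as [d Hd].
  exists d; split; [apply cond_pos|].
  intros h Hh.
  assert (Hb : ball (M := AbsRing_UniformSpace C_AbsRing) z d (z + h)).
  { change (Cmod (z + h - z)%C < d)%R.
    now replace (z + h - z) with h by ring. }
  specialize (Hd _ Hb).
  change (Cmod (f (z + h) - f z - (z + h - z) * l)%C
          <= eps * Cmod (z + h - z)%C)%R in Hd.
  now replace (z + h - z) with h in Hd by ring.
- intros H; split.
  + apply (is_linear_scal_l (V := AbsRing_NormedModule C_AbsRing)).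
  + intros w Hw.
    apply (is_filter_lim_locally_unique (V := AbsRing_NormedModule C_AbsRing)) in Hw.
    subst w; intros [eps Heps].
    destruct (H eps Heps) as [d [Hd0 Hd]].
    exists (mkposreal d Hd0); intros y Hy.
    change (Cmod (y - z)%C < d)%R in Hy.
    change (Cmod (f y - f z - (y - z) * l)%C <= eps * Cmod (y - z)%C)%R.
    specialize (Hd (y - z) Hy).
    now replace (z + (y - z)) with (y : C) in Hd by (simpl in y; ring).
Qed.

Lemma is_Cderive_ext (f g : C -> C) (z l l' : C) :
  (forall w, f w = g w) -> l = l' -> is_Cderive f z l -> is_Cderive g z l'.
Proof.
intros E <-.
exact (@is_derive_ext C_AbsRing (AbsRing_NormedModule C_AbsRing) f g z l E).
Qed.

Lemma is_Cderive_plus (f g : C -> C) (z l m : C) :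
  is_Cderive f z l -> is_Cderive g z m ->
  is_Cderive (fun w => f w + g w) z (l + m).
Proof.
exact (@is_derive_plus C_AbsRing (AbsRing_NormedModule C_AbsRing) f g z l m).
Qed.

Lemma is_Cderive_mult (f g : C -> C) (z l m : C) :
  is_Cderive f z l -> is_Cderive g z m ->
  is_Cderive (fun w => f w * g w) z (l * g z + f z * m).
Proof.
intros Hf Hg.
exact (@is_derive_mult C_AbsRing f g z l m Hf Hg Cmult_comm).
Qed.

Lemma is_Cderive_comp (f g : C -> C) (z l m : C) :
  is_Cderive f (g z) l -> is_Cderive g z m ->
  is_Cderive (fun w => f (g w)) z (m * l).
Proof.
exact (@is_derive_comp C_AbsRing (AbsRing_NormedModule C_AbsRing) f g z l m).
Qed.

Lemma is_Cderive_const (a z : C) : is_Cderive (fun _ => a) z 0.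
Proof. exact (@is_derive_const C_AbsRing (AbsRing_NormedModule C_AbsRing) a z). Qed.

Lemma is_Cderive_id (z : C) : is_Cderive (fun w => w) z 1.
Proof. exact (@is_derive_id C_AbsRing z). Qed.

Lemma is_Cderive_scal (c : C) (f : C -> C) (z l : C) :
  is_Cderive f z l -> is_Cderive (fun w => c * f w) z (c * l).
Proof.
intros H.
refine (is_Cderive_ext _ _ _ _ _ (fun w => eq_refl) _
          (is_Cderive_mult _ _ _ _ _ (is_Cderive_const c z) H)).
ring.
Qed.

Lemma is_Cderive_minus (f g : C -> C) (z l m : C) :
  is_Cderive f z l -> is_Cderive g z m ->
  is_Cderive (fun w => f w - g w) z (l - m).
Proof.
intros Hf Hg.
refine (is_Cderive_ext _ _ _ _ _ _ _
  (is_Cderive_plus _ _ _ _ _ Hf (is_Cderive_scal (-(1)) _ _ _ Hg)));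
  [intros w|]; ring.
Qed.

Lemma is_Cderive_sqr (f : C -> C) (z l : C) :
  is_Cderive f z l -> is_Cderive (fun w => f w ^ 2) z (2 * f z * l).
Proof.
intros H.
refine (is_Cderive_ext _ _ _ _ _ _ _ (is_Cderive_mult _ _ _ _ _ H H));
  [intros w; simpl|]; ring.
Qed.

Lemma norm_C_R (c : C) : norm (V := C_R_NormedModule) c = Cmod c.
Proof.
change (sqrt (Rabs (fst c) ^ 2 + Rabs (snd c) ^ 2) = Cmod c)%R.
now rewrite !pow2_abs.
Qed.

(** Restriction to a ray through the origin makes the fundamental theorem of
    calculus for functions of a real variable available. *)
Lemma is_Cderive_ray (f : C -> C) (z l : C) (u : R) :
  is_Cderive f (RtoC u * z) l ->
  is_derive (V := C_R_NormedModule) (fun v : R => f (RtoC v * z)) u (z * l).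
Proof.
intros H; rewrite is_Cderive_eps in H; split.
- apply (is_linear_scal_l (K := R_AbsRing) (V := C_R_NormedModule)).
- intros w Hw.
  apply (is_filter_lim_locally_unique (V := R_NormedModule)) in Hw.
  subst w; intros [eps Heps].
  assert (Hz : (0 < Cmod z + 1)%R) by (pose proof (Cmod_ge_0 z); lra).
  destruct (H (eps / (Cmod z + 1))%R) as [d [Hd0 Hd]].
  { now apply Rdiv_lt_0_compat. }
  exists (mkposreal (d / (Cmod z + 1)) (Rdiv_lt_0_compat _ _ Hd0 Hz)).
  intros y Hy.
  change (Rabs (y - u) < d / (Cmod z + 1))%R in Hy.
  assert (Hh : Cmod (RtoC (y - u) * z) = (Rabs (y - u) * Cmod z)%R).
  { now rewrite Cmod_mult, Cmod_R. }
  assert (Hlt : (Rabs (y - u) * Cmod z < d)%R).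
  { apply Rle_lt_trans with (Rabs (y - u) * (Cmod z + 1))%R.
    - apply Rmult_le_compat_l; [apply Rabs_pos|lra].
    - apply (Rmult_lt_compat_r _ _ _ Hz) in Hy.
      replace (d / (Cmod z + 1) * (Cmod z + 1))%R with d in Hy by (field; lra).
      exact Hy. }
  rewrite <- Hh in Hlt; specialize (Hd _ Hlt); rewrite Hh in Hd.
  change (norm (V := C_R_NormedModule)
            (f (RtoC y * z) - f (RtoC u * z)
             - scal (V := C_R_NormedModule) (y - u)%R (z * l))%C
          <= eps * Rabs (y - u))%R.
  rewrite norm_C_R, scal_R_Cmult.
  replace (f (RtoC y * z) - f (RtoC u * z) - RtoC (y - u) * (z * l))
    with (f (RtoC u * z + RtoC (y - u) * z) - f (RtoC u * z) - RtoC (y - u) * z * l).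
  + eapply Rle_trans; [exact Hd|].
    replace (eps / (Cmod z + 1) * (Rabs (y - u) * Cmod z))%R
      with ((eps * Rabs (y - u)) * (Cmod z / (Cmod z + 1)))%R by (field; lra).
    rewrite <- (Rmult_1_r (eps * Rabs (y - u))) at 2.
    apply Rmult_le_compat_l.
    * apply Rmult_le_pos; [lra|apply Rabs_pos].
    * apply (Rmult_le_reg_r (Cmod z + 1)); [lra|].
      unfold Rdiv; rewrite Rmult_assoc, Rinv_l; lra.
  + replace (RtoC u * z + RtoC (y - u) * z) with (RtoC y * z)
      by (rewrite (RtoC_minus y u); ring).
    ring.
Qed.

(** [f z - f 0] is the integral over [0, 1] of the derivative of [u |-> f (u z)]. *)
Lemma Cderive_0_const (f : C -> C) (z : C) :
  (forall u : R, (0 <= u <= 1)%R -> is_Cderive f (RtoC u * z) 0) ->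
  f z = f 0.
Proof.
intros H.
assert (HI : is_RInt (V := C_R_CompleteNormedModule) (fun _ => zero) 0 1
               (minus (f (RtoC 1 * z)) (f (RtoC 0 * z)))).
{ apply (is_RInt_derive (V := C_R_CompleteNormedModule)
           (fun v : R => f (RtoC v * z))).
  - intros u; rewrite Rmin_left, Rmax_right by lra; intros Hu.
    pose proof (is_Cderive_ray f z 0 u (H u Hu)) as E.
    rewrite Cmult_0_r in E; exact E.
  - intros; apply continuous_const. }
pose proof (is_RInt_const (V := C_R_CompleteNormedModule) 0 1 zero) as H0.
apply is_RInt_unique in HI; apply is_RInt_unique in H0.
rewrite HI in H0; clear HI; rename H0 into HI.
rewrite (scal_zero_r (V := C_R_ModuleSpace)) in HI.
rewrite Cmult_1_l, Cmult_0_l in HI.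
change (f z - f 0 = 0) in HI.
replace (f z) with (f z - f 0 + f 0) by ring.
rewrite HI; ring.
Qed.

(** * Complex power series *)

Definition is_Cseries (a : nat -> C) (l : C) : Prop :=
  is_series (K := C_AbsRing) (V := C_NormedModule) a l.

Lemma is_Cseries_ext (a b : nat -> C) (l l' : C) :
  (forall n, a n = b n) -> l = l' -> is_Cseries a l -> is_Cseries b l'.
Proof.
intros E <-.
exact (@is_series_ext C_AbsRing C_NormedModule a b l E).
Qed.

Lemma is_Cseries_plus (a b : nat -> C) (l m : C) :
  is_Cseries a l -> is_Cseries b m -> is_Cseries (fun n => a n + b n) (l + m).
Proof. exact (@is_series_plus C_AbsRing C_NormedModule a b l m). Qed.

Lemma is_Cseries_scal (c : C) (a : nat -> C) (l : C) :
  is_Cseries a l -> is_Cseries (fun n => c * a n) (c * l).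
Proof. exact (@is_series_scal C_AbsRing C_NormedModule c a l). Qed.

Lemma is_Cseries_minus (a b : nat -> C) (l m : C) :
  is_Cseries a l -> is_Cseries b m -> is_Cseries (fun n => a n - b n) (l - m).
Proof. exact (@is_series_minus C_AbsRing C_NormedModule a b l m). Qed.

Lemma is_Cseries_shift (a : nat -> C) (l : C) :
  is_Cseries (fun n => a (S n)) l ->
  is_Cseries a (a O + l).
Proof.
intros H; apply (@is_series_decr_1 C_AbsRing C_NormedModule a (a O + l)).
refine (is_Cseries_ext _ _ _ _ (fun n => eq_refl) _ H).
change (l = a O + l - a O); ring.
Qed.

Lemma is_Cseries_unique (a : nat -> C) (l m : C) :
  is_Cseries a l -> is_Cseries a m -> l = m.
Proof.
exact (@filterlim_locally_unique nat C_AbsRing C_NormedModule eventually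
         (Proper_StrongProper _ eventually_filter)
         (sum_n (G := C_AbelianMonoid) a) l m).
Qed.

Lemma is_Cseries_Cmod_le (a : nat -> C) (b : nat -> R) (l : C) (L : R) :
  (forall n, Cmod (a n) <= b n)%R ->
  is_Cseries a l -> is_series b L -> (Cmod l <= L)%R.
Proof.
intros Hab Ha Hb.
apply (is_lim_seq_le (fun n => Cmod (sum_n (G := C_AbelianMonoid) a n))
         (sum_n b) (Cmod l) L).
- intros n; unfold sum_n.
  eapply Rle_trans; [exact (norm_sum_n_m (V := C_NormedModule) a 0 n)|].
  now apply sum_n_m_le.
- exact (filterlim_comp _ _ _ _ _ _ _ _ Ha
           (filterlim_norm (V := C_NormedModule) l)).
- exact Hb.
Qed.

Lemma ex_Cseries_geom (a : nat -> C) (A q : R) :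
  (0 <= q < 1)%R -> (forall n, Cmod (a n) <= A * q ^ n)%R ->
  exists l, is_Cseries a l.
Proof.
intros Hq Ha.
apply (ex_series_le (V := C_CompleteNormedModule) a (fun n => A * q ^ n)%R).
- exact Ha.
- apply (ex_series_scal (V := R_NormedModule) A), ex_series_geom.
  rewrite Rabs_right; lra.
Qed.

Lemma is_Cseries_shift_0 (a : nat -> C) (l : C) :
  a O = 0 -> is_Cseries (fun n => a (S n)) l -> is_Cseries a l.
Proof.
intros H0 H; apply is_Cseries_shift in H.
refine (is_Cseries_ext _ _ _ _ (fun n => eq_refl) _ H).
rewrite H0; ring.
Qed.

Lemma is_Cseries_0 : is_Cseries (fun _ => 0) 0.
Proof.
destruct (ex_Cseries_geom (fun _ => 0) 0 0) as [l Hl]; [lra| |].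
- intros n; rewrite Cmod_0; lra.
- refine (is_Cseries_ext _ _ _ _ _ _ (is_Cseries_scal 0 _ _ Hl));
    [intros n|]; apply Cmult_0_l.
Qed.

Lemma is_Cseries_at_0 (a : nat -> C) (l : C) :
  is_Cseries (fun n => a n * 0 ^ n) l -> l = a O.
Proof.
intros H; apply (is_Cseries_unique _ _ _ H).
assert (H0 : is_Cseries (fun n => a (S n) * 0 ^ S n) 0).
{ refine (is_Cseries_ext _ _ _ _ _ eq_refl is_Cseries_0).
  intros n; rewrite Cpow_S; ring. }
refine (is_Cseries_ext _ _ _ _ (fun n => eq_refl) _
          (is_Cseries_shift (fun n => a n * 0 ^ n) 0 H0)).
simpl; ring.
Qed.

(** A Cauchy estimate for radius [r]: unlike convergence on the disc, it also bounds
    the remainders in [is_Cderive_Cseries]. *)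
Definition geom_bounded (r : R) (a : nat -> C) : Prop :=
  exists A : R, forall n, (Cmod (a n) <= A * (/ r) ^ n)%R.

Lemma geom_bounded_le (r r' : R) (a : nat -> C) :
  (0 < r' <= r)%R -> geom_bounded r a -> geom_bounded r' a.
Proof.
intros Hr [A HA]; exists A; intros n.
assert (H0 : (0 <= A)%R)
  by (generalize (HA O) (Cmod_ge_0 (a O)); simpl; lra).
eapply Rle_trans; [apply HA|].
apply Rmult_le_compat_l; [exact H0|].
apply pow_incr; split.
- apply Rlt_le, Rinv_0_lt_compat; lra.
- apply Rinv_le_contravar; lra.
Qed.

Lemma ex_Cseries_geom_bounded (r : R) (a : nat -> C) (t : C) :
  geom_bounded r a -> (Cmod t < r)%R ->
  exists s, is_Cseries (fun n => a n * t ^ n) s.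
Proof.
intros [A HA] Ht; pose proof (Cmod_ge_0 t) as Ht0.
apply (ex_Cseries_geom _ A (/ r * Cmod t)).
- split.
  + apply Rmult_le_pos; [apply Rlt_le, Rinv_0_lt_compat|]; lra.
  + apply (Rmult_lt_reg_l r); [lra|]; rewrite <- Rmult_assoc, Rinv_r; lra.
- intros n; rewrite Cmod_mult, Cmod_pow, Rpow_mult_distr, <- Rmult_assoc.
  apply Rmult_le_compat_r; [now apply pow_le|apply HA].
Qed.

(** By the binomial formula the left side without [d ^ 2] is at most
    [sum_(k >= 2) C(n,k) |h|^k |t|^(n-k)], and each [|h|^k] is at most
    [(|h|/d)^2 d^k].  The proof uses that both second-order remainders obey the same
    recurrence in [n]. *)
Lemma Cpow_taylor (t h : C) (d : R) (n : nat) : (Cmod h <= d)%R ->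
  (Cmod ((t + h) ^ n - t ^ n - RtoC (INR n) * h * t ^ pred n)%C * d ^ 2
   <= Cmod h ^ 2 * ((Cmod t + d) ^ n - Cmod t ^ n - INR n * d * Cmod t ^ pred n))%R.
Proof.
intros Hd; pose proof (Cmod_ge_0 h) as Hh; pose proof (Cmod_ge_0 t) as Ht.
induction n as [|n IH].
- simpl; replace (1 - 1 - 0 * h * 1) with (0 : C) by ring.
  rewrite Cmod_0; lra.
- assert (EC : (t + h) ^ S n - t ^ S n - RtoC (INR (S n)) * h * t ^ pred (S n)
    = (t + h) * ((t + h) ^ n - t ^ n - RtoC (INR n) * h * t ^ pred n)
      + RtoC (INR n) * h ^ 2 * t ^ pred n).
  { destruct n as [|k]; [simpl; ring|].
    rewrite (S_INR (S k)), RtoC_plus, !Cpow_S; simpl pred.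
    rewrite ?Cpow_S; ring. }
  assert (ER : ((Cmod t + d) ^ S n - Cmod t ^ S n - INR (S n) * d * Cmod t ^ pred (S n)
    = (Cmod t + d) * ((Cmod t + d) ^ n - Cmod t ^ n - INR n * d * Cmod t ^ pred n)
      + INR n * d ^ 2 * Cmod t ^ pred n)%R).
  { destruct n as [|k]; [simpl; ring|].
    rewrite (S_INR (S k)); simpl pred; simpl pow; ring. }
  rewrite EC, ER; clear EC ER.
  set (E := (t + h) ^ n - t ^ n - RtoC (INR n) * h * t ^ pred n) in *.
  set (X := ((Cmod t + d) ^ n - Cmod t ^ n - INR n * d * Cmod t ^ pred n)%R) in *.
  assert (Hs : (Cmod ((t + h) * E + RtoC (INR n) * h ^ 2 * t ^ pred n)%C
     <= (Cmod t + d) * Cmod E + INR n * Cmod h ^ 2 * Cmod t ^ pred n)%R).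
  { eapply Rle_trans; [apply Cmod_triangle|].
    rewrite !Cmod_mult, !Cmod_pow, Cmod_R, (Rabs_right (INR n))
      by (apply Rle_ge, pos_INR).
    apply Rplus_le_compat_r, Rmult_le_compat_r; [apply Cmod_ge_0|].
    pose proof (Cmod_triangle t h); lra. }
  pose proof (pow2_ge_0 d) as Hd2.
  apply (Rmult_le_compat_r _ _ _ Hd2) in Hs.
  assert (H1 : ((Cmod t + d) * (Cmod E * d ^ 2)
                <= (Cmod t + d) * (Cmod h ^ 2 * X))%R)
    by (apply Rmult_le_compat_l; [lra|exact IH]).
  lra.
Qed.

(** With [d] half the distance from [z] to the circle of radius [r],
    [Cpow_taylor] bounds the remainder [f (z + h) - f z - h g] by a multiple of
    [|h|^2 / d^2] times the geometric series of ratio [(|z| + d) / r]. *)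
Lemma is_Cderive_Cseries (a : nat -> C) (f : C -> C) (g z : C) (r : R) :
  geom_bounded r a -> (Cmod z < r)%R ->
  (forall t, (Cmod t < r)%R -> is_Cseries (fun n => a n * t ^ n) (f t)) ->
  is_Cseries (fun n => RtoC (INR (S n)) * a (S n) * z ^ n) g ->
  is_Cderive f z g.
Proof.
intros [A Ha] Hr Hf Hg.
assert (HA : (0 <= A)%R).
{ generalize (Ha O) (Cmod_ge_0 (a O)); simpl; lra. }
pose proof (Cmod_ge_0 z) as Hz0.
apply is_Cderive_eps; intros eps Heps.
pose (d := ((r - Cmod z) / 2)%R).
assert (Hd : (0 < d)%R) by (unfold d; lra).
assert (Hd2 : (Cmod z + d < r)%R) by (unfold d; lra).
pose (q := (/ r * (Cmod z + d))%R).
assert (Hq : (0 <= q < 1)%R).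
{ unfold q; split.
  - apply Rmult_le_pos; [apply Rlt_le, Rinv_0_lt_compat|]; lra.
  - apply (Rmult_lt_reg_l r); [lra|]; rewrite <- Rmult_assoc, Rinv_r; lra. }
pose (M := (A * / (1 - q))%R).
assert (HM : (0 <= M)%R).
{ apply Rmult_le_pos; [lra|]. apply Rlt_le, Rinv_0_lt_compat; lra. }
assert (Key : forall h, (Cmod h < d)%R ->
  (Cmod (f (z + h) - f z - h * g)%C <= Cmod h ^ 2 / d ^ 2 * M)%R).
{ intros h Hh.
  assert (Hzh : (Cmod (z + h)%C < r)%R)
    by (pose proof (Cmod_triangle z h); lra).
  assert (Hg' : is_Cseries (fun n => RtoC (INR n) * a n * z ^ pred n) g).
  { eapply is_Cseries_ext; [ | | exact (is_Cseries_shift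
        (fun n => RtoC (INR n) * a n * z ^ pred n) g Hg)].
    - reflexivity.
    - simpl; ring. }
  apply (is_Cseries_Cmod_le
    (fun n => a n * ((z + h) ^ n - z ^ n - RtoC (INR n) * h * z ^ pred n))
    (fun n => (Cmod h ^ 2 / d ^ 2 * (A * q ^ n))%R)).
  - intros n; rewrite Cmod_mult.
    pose proof (Cpow_taylor z h d n (Rlt_le _ _ Hh)) as HT.
    set (E := Cmod (_ - _ - _)) in *.
    assert (HE : (E <= Cmod h ^ 2 / d ^ 2 * (Cmod z + d) ^ n)%R).
    { apply (Rmult_le_reg_r (d ^ 2)); [now apply pow_lt|].
      eapply Rle_trans; [exact HT|].
      replace (Cmod h ^ 2 / d ^ 2 * (Cmod z + d) ^ n * d ^ 2)%R
        with (Cmod h ^ 2 * (Cmod z + d) ^ n)%R by (field; lra).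
      apply Rmult_le_compat_l; [apply pow2_ge_0|].
      pose proof (pow_le (Cmod z) n Hz0).
      assert (0 <= INR n * d * Cmod z ^ pred n)%R.
      { apply Rmult_le_pos; [apply Rmult_le_pos; [apply pos_INR|lra]|].
        now apply pow_le. }
      lra. }
    unfold q; rewrite Rpow_mult_distr.
    replace (Cmod h ^ 2 / d ^ 2 * (A * ((/ r) ^ n * (Cmod z + d) ^ n)))%R
      with ((A * (/ r) ^ n) * (Cmod h ^ 2 / d ^ 2 * (Cmod z + d) ^ n))%R by ring.
    apply Rmult_le_compat; auto; apply Cmod_ge_0.
  - eapply is_Cseries_ext; [ | | exact (is_Cseries_minus _ _ _ _
      (is_Cseries_minus _ _ _ _ (Hf _ Hzh) (Hf _ Hr))
      (is_Cseries_scal h _ _ Hg'))]; [intros n; simpl; ring|reflexivity].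
  - unfold M; apply (is_series_scal (V := R_NormedModule) (Cmod h ^ 2 / d ^ 2)%R).
    apply (is_series_scal (V := R_NormedModule) A), is_series_geom.
    rewrite Rabs_right; lra. }
pose (c := (M / d ^ 2)%R).
assert (Hc : (0 <= c)%R).
{ apply Rmult_le_pos; [lra|]. now apply Rlt_le, Rinv_0_lt_compat, pow_lt. }
exists (Rmin d (eps / (c + 1))); split.
- apply Rmin_glb_lt; [exact Hd|apply Rdiv_lt_0_compat; lra].
- intros h Hh.
  pose proof (Rmin_l d (eps / (c + 1))); pose proof (Rmin_r d (eps / (c + 1))).
  pose proof (Cmod_ge_0 h).
  eapply Rle_trans; [apply Key; lra|].
  replace (Cmod h ^ 2 / d ^ 2 * M)%R with ((c * Cmod h) * Cmod h)%R
    by (unfold c; field; lra).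
  apply Rmult_le_compat_r; [lra|].
  apply Rle_trans with ((c + 1) * (eps / (c + 1)))%R.
  + apply Rmult_le_compat; lra.
  + right; field; lra.
Qed.

(** * The complex exponential and logarithm *)

Lemma Cexp_plus (z w : C) : Cexp (z + w) = Cexp z * Cexp w.
Proof.
unfold Cexp, Cmult, Re, Im; simpl.
rewrite exp_plus, cos_plus, sin_plus; f_equal; ring.
Qed.

Lemma Cexp_0 : Cexp 0 = 1.
Proof.
unfold Cexp, Re, Im; simpl; rewrite exp_0, cos_0, sin_0.
unfold RtoC; f_equal; ring.
Qed.

Lemma Cexp_opp_r (z : C) : Cexp z * Cexp (- z) = 1.
Proof.
rewrite <- Cexp_plus, <- Cexp_0; f_equal; ring.
Qed.

Lemma Cexp_neq_0 (z : C) : Cexp z <> 0.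
Proof.
intros E; apply C1_nz; rewrite <- (Cexp_opp_r z), E; ring.
Qed.

Lemma derivable_pt_lim_0_eps (f : R -> R) (l eps : R) :
  derivable_pt_lim f 0 l -> (0 < eps)%R ->
  exists d : R, (0 < d)%R /\
    forall h, (Rabs h < d)%R -> (Rabs (f h - f 0 - l * h) <= eps * Rabs h)%R.
Proof.
intros H He; destruct (H eps He) as [d Hd].
exists d; split; [apply cond_pos|]; intros h Hh.
destruct (Req_dec h 0) as [->|Hn].
- replace (f 0 - f 0 - l * 0)%R with 0%R by ring.
  rewrite Rabs_R0; lra.
- specialize (Hd h Hn Hh); rewrite Rplus_0_l in Hd.
  replace (f h - f 0 - l * h)%R with (((f h - f 0) / h - l) * h)%R by (now field).
  rewrite Rabs_mult; apply Rmult_le_compat_r; [apply Rabs_pos|lra].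
Qed.

(** For [h = a + i b], [e^h - 1 - h] is the sum of [e^a - 1 - a],
    [e^a (e^(i b) - 1 - i b)] and [(e^a - 1) i b]; the derivatives at 0 of the real
    functions [exp], [cos] and [sin] make each of them small. *)
Lemma Cexp_eps_0 (eps : R) : (0 < eps)%R ->
  exists d : R, (0 < d)%R /\
    forall h : C, (Cmod h < d)%R -> (Cmod (Cexp h - 1 - h)%C <= eps * Cmod h)%R.
Proof.
intros He.
pose (e := Rmin 1 (eps / 6)).
assert (He0 : (0 < e)%R) by (apply Rmin_glb_lt; lra).
pose proof (Rmin_l 1 (eps / 6)) as He1; pose proof (Rmin_r 1 (eps / 6)) as He2.
fold e in He1, He2.
destruct (derivable_pt_lim_0_eps exp 1 e derivable_pt_lim_exp_0 He0)
  as [d1 [Hd1 H1]].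
assert (Hs : derivable_pt_lim sin 0 1)
  by (rewrite <- cos_0; apply derivable_pt_lim_sin).
assert (Hc : derivable_pt_lim cos 0 0)
  by (rewrite <- Ropp_0, <- sin_0 at 2; apply derivable_pt_lim_cos).
destruct (derivable_pt_lim_0_eps sin 1 e Hs He0) as [d2 [Hd2 H2]].
destruct (derivable_pt_lim_0_eps cos 0 e Hc He0) as [d3 [Hd3 H3]].
exists (Rmin (Rmin d1 d2) (Rmin d3 (e / 2))); split.
{ repeat apply Rmin_glb_lt; lra. }
intros h Hh.
apply Rmin_Rgt in Hh as [Hh1 Hh2].
apply Rmin_Rgt in Hh1 as [Hh1 Hh1'].
apply Rmin_Rgt in Hh2 as [Hh2 Hh2'].
set (a := Re h); set (b := Im h).
assert (Ha : (Rabs a <= Cmod h)%R) by apply re_le_Cmod.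
assert (Hb : (Rabs b <= Cmod h)%R).
{ eapply Rle_trans; [|apply (Rmax_Cmod h)]; apply Rmax_r. }
specialize (H1 a ltac:(lra)); specialize (H2 b ltac:(lra)).
specialize (H3 b ltac:(lra)).
rewrite exp_0 in H1; rewrite sin_0 in H2; rewrite cos_0 in H3.
assert (Hea : (Rabs (exp a - 1) <= 2 * Rabs a)%R).
{ replace (exp a - 1)%R with ((exp a - 1 - 1 * a) + a)%R by ring.
  eapply Rle_trans; [apply Rabs_triang|].
  assert (e * Rabs a <= 1 * Rabs a)%R
    by (apply Rmult_le_compat_r; [apply Rabs_pos|lra]); lra. }
assert (Hea2 : (exp a <= 2)%R).
{ assert (Hx := Rle_abs (exp a - 1)); lra. }
pose proof (exp_pos a) as Hep.
pose (E1 := (RtoC (exp a - 1 - 1 * a))).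
pose (E2 := ((cos b - 1 - 0 * b)%R, (sin b - 0 - 1 * b)%R) : C).
pose (E3 := RtoC ((exp a - 1) * b) * Ci).
assert (EQ : Cexp h - 1 - h = E1 + RtoC (exp a) * E2 + E3).
{ unfold E1, E2, E3, a, b; clear; destruct h as [p q].
  unfold Cexp, Cminus, Cplus, Copp, Cmult, RtoC, Ci, Re, Im; simpl.
  f_equal; ring. }
rewrite EQ.
eapply Rle_trans; [apply Cmod_triangle|].
assert (HE3 : (Cmod E3 <= e * Cmod h)%R).
{ unfold E3; rewrite Cmod_mult, Cmod_R, Rabs_mult.
  rewrite Cmod_Ci, Rmult_1_r; apply Rmult_le_compat; try apply Rabs_pos; lra. }
assert (HE2 : (Cmod E2 <= 2 * (e * Cmod h))%R).
{ eapply Rle_trans; [apply Cmod_Re_Im_le|]; unfold E2, Re, Im; simpl.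
  assert (e * Rabs b <= e * Cmod h)%R
    by (apply Rmult_le_compat_l; lra); lra. }
assert (HE1 : (Cmod E1 <= e * Cmod h)%R).
{ unfold E1; rewrite Cmod_R; eapply Rle_trans; [exact H1|].
  apply Rmult_le_compat_l; lra. }
pose proof (Cmod_triangle E1 (RtoC (exp a) * E2)) as HT.
rewrite Cmod_mult, Cmod_R, (Rabs_right (exp a)) in HT by lra.
assert (exp a * Cmod E2 <= 2 * (2 * (e * Cmod h)))%R
  by (apply Rmult_le_compat; try lra; apply Cmod_ge_0).
assert (6 * e * Cmod h <= eps * Cmod h)%R
  by (apply Rmult_le_compat_r; [apply Cmod_ge_0|lra]).
lra.
Qed.

Lemma is_Cderive_Cexp (z : C) : is_Cderive Cexp z (Cexp z).
Proof.
apply is_Cderive_eps; intros eps He.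
assert (Hp : (0 < Cmod (Cexp z))%R) by apply Cmod_gt_0, Cexp_neq_0.
destruct (Cexp_eps_0 (eps / Cmod (Cexp z))) as [d [Hd H]].
{ now apply Rdiv_lt_0_compat. }
exists d; split; [exact Hd|]; intros h Hh.
replace (Cexp (z + h) - Cexp z - h * Cexp z)
  with (Cexp z * (Cexp h - 1 - h)) by (rewrite Cexp_plus; ring).
rewrite Cmod_mult.
replace (eps * Cmod h)%R
  with (Cmod (Cexp z) * (eps / Cmod (Cexp z) * Cmod h))%R by (field; lra).
apply Rmult_le_compat_l; [lra|auto].
Qed.

(** With [q = tan (arg z / 2) = Im z / (|z| + Re z)], the double-angle formulas give
    [cos (arg z) = (1 - q^2) / (1 + q^2)] and [sin (arg z) = 2 q / (1 + q^2)]. *)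
Lemma Cexp_Clog (z : C) : (0 < Re z)%R -> Cexp (Clog z) = z.
Proof.
intros Hz.
pose proof (Re_pos_Cmod_pos z Hz) as Hr.
pose proof (Cmod_sqr z) as Hsq.
unfold Cexp, Clog, Carg; simpl.
change (fst z) with (Re z).
rewrite exp_ln by exact Hr.
set (q := (Im z / (Cmod z + Re z))%R).
set (s := sqrt (1 + q²)).
assert (Hs : (s * s = 1 + q * q)%R).
{ apply sqrt_sqrt; pose proof (Rle_0_sqr q); unfold Rsqr in *; lra. }
assert (Hq1 : (0 < 1 + q * q)%R) by (pose proof (Rle_0_sqr q); unfold Rsqr in *; lra).
assert (Hs0 : (s <> 0)%R) by (intros E; rewrite E in Hs; lra).
assert (Hq : (Im z = q * (Cmod z + Re z))%R) by (unfold q; field; lra).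
assert (E1 : (Cmod z * (1 - q * q) = Re z * (1 + q * q))%R).
{ apply (Rmult_eq_reg_l ((Cmod z + Re z) * (Cmod z + Re z))%R).
  2: { apply Rgt_not_eq, Rmult_lt_0_compat; lra. }
  replace ((Cmod z + Re z) * (Cmod z + Re z) * (Cmod z * (1 - q * q)))%R
   with (Cmod z * ((Cmod z + Re z) * (Cmod z + Re z)
      - (q * (Cmod z + Re z)) * (q * (Cmod z + Re z))))%R by ring.
  replace ((Cmod z + Re z) * (Cmod z + Re z) * (Re z * (1 + q * q)))%R
   with (Re z * ((Cmod z + Re z) * (Cmod z + Re z)
      + (q * (Cmod z + Re z)) * (q * (Cmod z + Re z))))%R by ring.
  rewrite <- Hq.
  replace (Im z * Im z)%R with (Cmod z * Cmod z - Re z * Re z)%R by lra.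
  ring. }
rewrite cos_2a, sin_2a, cos_atan, sin_atan; fold s.
assert (Ec : (1 / s * (1 / s) - q / s * (q / s) = (1 - q * q) / (1 + q * q))%R).
{ rewrite <- Hs; field; lra. }
assert (Es : (2 * (q / s) * (1 / s) = 2 * q / (1 + q * q))%R).
{ rewrite <- Hs; field; lra. }
rewrite Ec, Es.
transitivity (Re z, Im z); [|now destruct z].
f_equal.
- replace (Cmod z * ((1 - q * q) / (1 + q * q)))%R
    with ((Cmod z * (1 - q * q)) / (1 + q * q))%R by (field; lra).
  rewrite E1; field; lra.
- rewrite Hq.
  replace (q * (Cmod z + Re z))%R
    with (q * (Cmod z * (1 + q * q) + Re z * (1 + q * q)) / (1 + q * q))%R
    by (field; lra).
  rewrite <- E1; field; lra.
Qed.

Lemma continuous_C_eps (f : C -> R) (z : C) (eps : R) :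
  continuous (T := C_UniformSpace) (U := R_UniformSpace) f z -> (0 < eps)%R ->
  exists d : R, (0 < d)%R /\
    forall h : C, (Cmod h < d)%R -> (Rabs (f (z + h)%C - f z) < eps)%R.
Proof.
intros Hf He.
pose proof (Hf (ball (M := R_UniformSpace) (f z) (mkposreal eps He))
  (locally_ball (f z) (mkposreal eps He))) as H.
apply (locally_C z) in H; destruct H as [d Hd].
exists d; split; [apply cond_pos|]; intros h Hh.
apply (Hd (z + h)).
change (Cmod (z + h - z)%C < d)%R.
now replace (z + h - z) with h by ring.
Qed.

Lemma continuous_Cmod (z : C) :
  continuous (T := C_UniformSpace) (U := R_UniformSpace) Cmod z.
Proof. exact (filterlim_norm (V := C_NormedModule) z). Qed.

Lemma continuous_Clog (z : C) (eps : R) : (0 < Re z)%R -> (0 < eps)%R ->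
  exists d : R, (0 < d)%R /\
    forall h : C, (Cmod h < d)%R -> (Cmod (Clog (z + h) - Clog z)%C < eps)%R.
Proof.
intros Hz He.
pose proof (Re_pos_Cmod_pos z Hz) as Hr.
assert (HRe : continuous (T := C_UniformSpace) (U := R_UniformSpace) Re z).
{ destruct z as [x y]; exact (continuous_fst (U := R_UniformSpace) (V := R_UniformSpace) x y). }
assert (HIm : continuous (T := C_UniformSpace) (U := R_UniformSpace) Im z).
{ destruct z as [x y]; exact (continuous_snd (U := R_UniformSpace) (V := R_UniformSpace) x y). }
assert (H1 : continuous (T := C_UniformSpace) (U := R_UniformSpace)
               (fun w => ln (Cmod w)) z).
{ apply (continuous_comp (U := C_UniformSpace) (V := R_UniformSpace)
           (W := R_UniformSpace) Cmod ln).
  - apply continuous_Cmod.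
  - now apply continuous_ln. }
assert (H2 : continuous (T := C_UniformSpace) (U := R_UniformSpace) Carg z).
{ apply (continuous_mult (U := C_UniformSpace) (K := R_AbsRing)
           (fun _ => 2%R) (fun w => atan (Im w / (Cmod w + Re w)))).
  - apply continuous_const.
  - apply (continuous_comp (U := C_UniformSpace) (V := R_UniformSpace)
           (W := R_UniformSpace) (fun w => (Im w / (Cmod w + Re w))%R) atan);
      [|apply continuous_atan].
    apply (continuous_mult (U := C_UniformSpace) (K := R_AbsRing)
           Im (fun w => (/ (Cmod w + Re w))%R)); [exact HIm|].
    apply (continuous_comp (U := C_UniformSpace) (V := R_UniformSpace)
           (W := R_UniformSpace) (fun w => (Cmod w + Re w)%R) Rinv).
    + apply (continuous_plus (U := C_UniformSpace) (V := R_NormedModule) Cmod Re);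
        [apply continuous_Cmod|exact HRe].
    + apply continuous_Rinv; lra. }
assert (He2 : (0 < eps / 2)%R) by lra.
destruct (continuous_C_eps _ z _ H1 He2) as [d1 [Hd1 K1]].
destruct (continuous_C_eps _ z _ H2 He2) as [d2 [Hd2 K2]].
exists (Rmin d1 d2); split; [now apply Rmin_glb_lt|]; intros h Hh.
apply Rmin_Rgt in Hh as [Hh1 Hh2].
specialize (K1 h Hh1); specialize (K2 h Hh2).
eapply Rle_lt_trans; [apply Cmod_Re_Im_le|].
change (Rabs (ln (Cmod (z + h)%C) - ln (Cmod z))
        + Rabs (Carg (z + h) - Carg z) < eps)%R.
lra.
Qed.

(** The derivative of an inverse function: [h = log (z + k) - log z] tends to 0 with
    [k] by continuity, and [e^h - 1 = k / z], so [h] and [k / z] differ by [o(h)],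
    which is [o(k)]. *)
Lemma is_Cderive_Clog (z : C) : (0 < Re z)%R -> is_Cderive Clog z (/ z).
Proof.
intros Hz.
pose proof (Re_pos_Cmod_pos z Hz) as Hr.
assert (Hz0 : z <> 0) by now apply Cmod_gt_0.
apply is_Cderive_eps; intros eps He.
pose (e := Rmin (/ 2) (eps * Cmod z / 2)).
assert (He0 : (0 < e)%R).
{ apply Rmin_glb_lt; [lra|].
  apply Rdiv_lt_0_compat; [now apply Rmult_lt_0_compat|lra]. }
destruct (Cexp_eps_0 e He0) as [d1 [Hd1 K1]].
destruct (continuous_Clog z d1 Hz Hd1) as [d2 [Hd2 K2]].
exists (Rmin d2 (Re z)); split; [now apply Rmin_glb_lt|]; intros k Hk.
apply Rmin_Rgt in Hk as [Hk1 Hk2].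
specialize (K2 k Hk1); specialize (K1 _ K2).
set (h := Clog (z + k) - Clog z) in *.
assert (Hzk : (0 < Re (z + k)%C)%R).
{ change (0 < Re z + Re k)%R.
  pose proof (re_le_Cmod k); pose proof (Rle_abs (- Re k)); rewrite Rabs_Ropp in *.
  lra. }
assert (Hexp : Cexp h - 1 = k / z).
{ assert (E : Cexp h * z = z + k).
  { rewrite <- (Cexp_Clog z Hz) at 1.
    rewrite <- Cexp_plus, <- (Cexp_Clog (z + k) Hzk); f_equal; unfold h; ring. }
  replace (Cexp h) with (Cexp h * z / z) by (now field).
  rewrite E; now field. }
rewrite Hexp in K1.
assert (Hh : (Cmod h <= 2 * (Cmod k / Cmod z))%R).
{ assert (Hle : (Cmod h <= Cmod (k / z)%C + Cmod (k / z - h)%C)%R).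
  { rewrite <- (Cmod_opp (k / z - h)).
    replace h with (k / z + - (k / z - h)) at 1 by ring.
    apply Cmod_triangle. }
  rewrite Cmod_div in Hle by exact Hz0.
  assert (e * Cmod h <= / 2 * Cmod h)%R.
  { apply Rmult_le_compat_r; [apply Cmod_ge_0|apply Rmin_l]. }
  lra. }
fold h.
rewrite <- Cmod_opp.
replace (- (h - k * / z)) with (k / z - h) by (unfold Cdiv; ring).
eapply Rle_trans; [exact K1|].
apply Rle_trans with (e * (2 * (Cmod k / Cmod z)))%R.
{ apply Rmult_le_compat_l; lra. }
apply Rle_trans with ((eps * Cmod z / 2) * (2 * (Cmod k / Cmod z)))%R.
{ apply Rmult_le_compat_r; [|apply Rmin_r].
  pose proof (Cmod_ge_0 h); lra. }
right; field; lra.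
Qed.

(** * The derivative of erfi *)

Lemma entire_geom_bounded (a : nat -> C) (r : R) : (0 < r)%R ->
  (forall n, Cmod (a n) <= / INR (fact n))%R -> geom_bounded r a.
Proof.
intros Hr Ha.
destruct (maj_by_pos _ (exist _ 0%R (cv_speed_pow_fact r))) as [A [_ HA]].
exists A; intros n; eapply Rle_trans; [apply Ha|].
pose proof (pow_lt r n Hr) as Hp.
apply (Rmult_le_reg_l (r ^ n)); [exact Hp|].
rewrite pow_inv.
replace (r ^ n * (A * / r ^ n))%R with A by (field; lra).
eapply Rle_trans; [apply Rle_abs|exact (HA n)].
Qed.

Lemma ex_Cseries_entire (a : nat -> C) (y : C) :
  (forall n, Cmod (a n) <= / INR (fact n))%R ->
  exists l, is_Cseries (fun n => a n * y ^ n) l.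
Proof.
intros Ha; pose proof (Cmod_ge_0 y) as Hy.
apply (ex_Cseries_geom_bounded (Cmod y + 1)); [|lra].
apply entire_geom_bounded; [lra|exact Ha].
Qed.

Lemma is_Cderive_entire (a : nat -> C) (f : C -> C) (y g : C) :
  (forall n, Cmod (a n) <= / INR (fact n))%R ->
  (forall t, is_Cseries (fun n => a n * t ^ n) (f t)) ->
  is_Cseries (fun n => RtoC (INR (S n)) * a (S n) * y ^ n) g ->
  is_Cderive f y g.
Proof.
intros Ha Hf Hg; pose proof (Cmod_ge_0 y) as Hy.
apply (is_Cderive_Cseries a f g y (Cmod y + 1)); auto; [|lra].
apply entire_geom_bounded; [lra|exact Ha].
Qed.

(** The sum [E] of the series satisfies [E' = E] and [E 0 = 1], so [E e^(-t)] has
    derivative zero and equals 1. *)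
Lemma Cexp_series (y : C) :
  is_Cseries (fun n => / RtoC (INR (fact n)) * y ^ n) (Cexp y).
Proof.
pose (a := fun n : nat => / RtoC (INR (fact n))).
assert (Ha : forall n, (Cmod (a n) <= / INR (fact n))%R).
{ intros n; unfold a; rewrite Cmod_inv_fact; lra. }
pose (E := fun t => proj1_sig
  (constructive_indefinite_description _ (ex_Cseries_entire a t Ha))).
assert (HE : forall t, is_Cseries (fun n => a n * t ^ n) (E t)).
{ intros t; exact (proj2_sig
    (constructive_indefinite_description _ (ex_Cseries_entire a t Ha))). }
assert (HE' : forall t, is_Cderive E t (E t)).
{ intros t; apply (is_Cderive_entire a E t (E t) Ha HE).
  refine (is_Cseries_ext _ _ _ _ _ eq_refl (HE t)).
  intros n; f_equal; unfold a; rewrite RtoC_INR_S_fact.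
  field; split; [apply RtoC_INR_fact_neq_0|apply RtoC_INR_S_neq_0]. }
assert (K : E y * Cexp (- y) = E 0 * Cexp (- 0)).
{ apply (Cderive_0_const (fun t => E t * Cexp (- t))).
  intros u _; set (t := RtoC u * y).
  refine (is_Cderive_ext _ _ _ _ _ (fun w => eq_refl) _
    (is_Cderive_mult E (fun t => Cexp (- t)) t (E t) (-(1) * Cexp (- t)) (HE' t) _)).
  - ring.
  - apply (is_Cderive_comp Cexp Copp t); [apply is_Cderive_Cexp|].
    refine (is_Cderive_ext _ _ _ _ _ _ _
              (is_Cderive_scal (-(1)) _ _ _ (is_Cderive_id t)));
      [intros w|]; ring. }
rewrite (is_Cseries_at_0 a _ (HE 0)) in K.
replace (- 0) with (0 : C) in K by ring.
rewrite Cexp_0 in K; unfold a in K; simpl in K.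
replace (Cexp y) with (E y); [apply HE|].
replace (E y) with (E y * Cexp (- y) * Cexp y).
- rewrite K; field; apply C1_nz.
- rewrite <- Cmult_assoc, (Cmult_comm (Cexp (- y))), Cexp_opp_r; ring.
Qed.

(** The primitive is [w T(w^2)] with [T(y) = sum y^n / (n! (2n+1))]: its derivative
    is [T + 2 y T'] at [y = w^2], and the factor [2n+1] cancels, leaving the
    exponential series. *)
Lemma Cexp_sqr_primitive :
  exists P : C -> C, P 0 = 0 /\ forall w, is_Cderive P w (Cexp (w ^ 2)).
Proof.
pose (a := fun n : nat => / RtoC (INR (fact n)) * / RtoC (INR (2 * n + 1))).
assert (Hle1 : forall n, (Cmod (/ RtoC (INR (S n))) <= 1)%R).
{ intros n; rewrite <- RtoC_inv, Cmod_R by (apply not_0_INR; lia).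
  assert (1 <= INR (S n))%R by (rewrite S_INR; generalize (pos_INR n); lra).
  rewrite Rabs_right.
  - rewrite <- Rinv_1; apply Rinv_le_contravar; lra.
  - apply Rle_ge, Rlt_le, Rinv_0_lt_compat; lra. }
assert (Ha : forall n, (Cmod (a n) <= / INR (fact n))%R).
{ intros n; unfold a; rewrite Cmod_mult, Cmod_inv_fact.
  rewrite <- (Rmult_1_r (/ INR (fact n))) at 2.
  apply Rmult_le_compat_l.
  - apply Rlt_le, Rinv_0_lt_compat, INR_fact_pos.
  - replace (2 * n + 1)%nat with (S (2 * n)) by lia; apply Hle1. }
assert (Ha' : forall n, (Cmod (RtoC (INR (S n)) * a (S n)) <= / INR (fact n))%R).
{ intros n.
  replace (RtoC (INR (S n)) * a (S n))
    with (/ RtoC (INR (fact n)) * / RtoC (INR (S (2 * S n)))).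
  - rewrite Cmod_mult, Cmod_inv_fact.
    rewrite <- (Rmult_1_r (/ INR (fact n))) at 2.
    apply Rmult_le_compat_l; [|apply Hle1].
    apply Rlt_le, Rinv_0_lt_compat, INR_fact_pos.
  - unfold a; rewrite RtoC_INR_S_fact.
    replace (2 * S n + 1)%nat with (S (2 * S n)) by lia.
    field; repeat split; try apply RtoC_INR_S_neq_0; apply RtoC_INR_fact_neq_0. }
pose (T := fun t => proj1_sig
  (constructive_indefinite_description _ (ex_Cseries_entire a t Ha))).
assert (HT : forall t, is_Cseries (fun n => a n * t ^ n) (T t)).
{ intros t; exact (proj2_sig
    (constructive_indefinite_description _ (ex_Cseries_entire a t Ha))). }
exists (fun w => w * T (w ^ 2)); split; [ring|]; intros w.
set (y := w ^ 2).
destruct (ex_Cseries_entire (fun n => RtoC (INR (S n)) * a (S n)) y Ha') as [g Hg].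
assert (ET : T y + 2 * y * g = Cexp y).
{ assert (Hg' : is_Cseries (fun n => RtoC (INR n) * a n * y ^ n) (y * g)).
  { refine (is_Cseries_ext _ _ _ _ (fun n => eq_refl) _
      (is_Cseries_shift (fun n => RtoC (INR n) * a n * y ^ n) (y * g) _)).
    - simpl; ring.
    - refine (is_Cseries_ext _ _ _ _ _ eq_refl (is_Cseries_scal y _ _ Hg)).
      intros n; rewrite Cpow_S; ring. }
  apply (is_Cseries_unique (fun n => / RtoC (INR (fact n)) * y ^ n)).
  - refine (is_Cseries_ext _ _ _ _ _ _
      (is_Cseries_plus _ _ _ _ (HT y) (is_Cseries_scal 2 _ _ Hg'))).
    + intros n; unfold a.
      assert (E : RtoC (INR (2 * n + 1)) = 2 * RtoC (INR n) + 1).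
      { rewrite plus_INR, mult_INR, RtoC_plus, RtoC_mult; reflexivity. }
      assert (N : RtoC (INR (2 * n + 1)) <> 0)
        by (replace (2 * n + 1)%nat with (S (2 * n)) by lia; apply RtoC_INR_S_neq_0).
      rewrite E in N |- *.
      field; split; [apply RtoC_INR_fact_neq_0|exact N].
    + ring.
  - apply Cexp_series. }
assert (Hsq : is_Cderive (fun v => v ^ 2) w (2 * w)).
{ refine (is_Cderive_ext _ _ _ _ _ _ _
    (is_Cderive_mult _ _ _ _ _ (is_Cderive_id w) (is_Cderive_id w)));
    [intros v; simpl|]; ring. }
refine (is_Cderive_ext _ _ _ _ _ (fun v => eq_refl) _
  (is_Cderive_mult (fun v => v) (fun v => T (v ^ 2)) w 1 (2 * w * g)
     (is_Cderive_id w) _)).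
- fold y; rewrite <- ET; unfold y; simpl; ring.
- apply (is_Cderive_comp T (fun v => v ^ 2)); [|exact Hsq].
  exact (is_Cderive_entire a T y g Ha HT Hg).
Qed.

(** A primitive of [e^(w^2)] on the whole plane makes the integral over the segment
    from 0 to [w] a function with a complex derivative. *)
Lemma is_Cderive_erfi (w : C) :
  is_Cderive erfi w (2 / RtoC (sqrt PI) * Cexp (w ^ 2)).
Proof.
destruct Cexp_sqr_primitive as [P [HP0 HP]].
assert (E : forall z, 2 / RtoC (sqrt PI) * P z = erfi z).
{ intros z; unfold erfi; f_equal; symmetry.
  apply (is_RInt_unique (V := C_R_CompleteNormedModule)
           (fun u : R => z * Cexp ((RtoC u * z) ^ 2)) 0 1).
  replace (P z) with (minus (P (RtoC 1 * z)) (P (RtoC 0 * z))).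
  2: { rewrite Cmult_1_l, Cmult_0_l, HP0; change (P z - 0 = P z); ring. }
  apply (is_RInt_derive (V := C_R_CompleteNormedModule)
           (fun u : R => P (RtoC u * z))).
  - intros u _; exact (is_Cderive_ray P z _ u (HP _)).
  - intros u _.
    apply (ex_derive_continuous (V := C_R_NormedModule)
             (fun v : R => z * Cexp ((RtoC v * z) ^ 2))).
    eexists.
    apply (is_Cderive_ray (fun v => z * Cexp (v ^ 2))).
    apply is_Cderive_scal, (is_Cderive_comp Cexp (fun v => v ^ 2)).
    + apply is_Cderive_Cexp.
    + apply (is_Cderive_mult (fun v => v) (fun v => v * 1)); [apply is_Cderive_id|].
      apply (is_Cderive_mult (fun v => v) (fun v => 1));
        [apply is_Cderive_id|apply is_Cderive_const]. }
refine (is_Cderive_ext _ _ _ _ _ E eq_refl _).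
apply is_Cderive_scal, HP.
Qed.

(** * Growth of sequences with a Hermite recurrence *)

(** The step works as soon as [|a| B + D <= B^2], because
    [(n+1) sqrt(n!) <= sqrt((n+2)!)]: the linear growth of [b n] is exactly what
    [sqrt(n!)] absorbs. *)
Lemma three_term_growth (k b : nat -> C) (a : C) (D : R) :
  (forall n, k (S (S n)) = a * k (S n) - b n * k n) ->
  (0 <= D)%R -> (forall n, Cmod (b n) <= D * INR (S n))%R ->
  exists A B : R, (0 < B)%R /\
    forall n, (Cmod (k n) <= A * B ^ n * sqrt (INR (fact n)))%R.
Proof.
intros Hk HD Hb.
pose (A := (Cmod (k O) + Cmod (k 1%nat))%R).
pose (B := (Cmod a + D + 1)%R).
pose proof (Cmod_ge_0 a) as Ha.
pose proof (Cmod_ge_0 (k O)) as Hk0; pose proof (Cmod_ge_0 (k 1%nat)) as Hk1.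
assert (HA : (0 <= A)%R) by (unfold A; lra).
assert (HB : (1 <= B)%R) by (unfold B; lra).
assert (HBB : (Cmod a * B + D <= B ^ 2)%R).
{ unfold B; nra. }
exists A, B; split; [lra|].
assert (Hw1 : forall n, (sqrt (INR (fact (S n))) <= sqrt (INR (fact (S (S n)))))%R).
{ intros n; apply sqrt_le_1_alt, le_INR, fact_le; lia. }
assert (Hw2 : forall n, (INR (S n) * sqrt (INR (fact n))
                         <= sqrt (INR (fact (S (S n)))))%R).
{ intros n; pose proof (pos_INR (S n)) as Hn.
  rewrite <- (sqrt_Rsqr (INR (S n)) Hn), <- sqrt_mult_alt by apply Rle_0_sqr.
  apply sqrt_le_1_alt.
  change (fact (S (S n))) with (S (S n) * (S n * fact n))%nat.
  rewrite !mult_INR, <- Rmult_assoc; unfold Rsqr.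
  apply Rmult_le_compat_r; [apply pos_INR|].
  apply Rmult_le_compat_r; [exact Hn|apply le_INR; lia]. }
assert (H : forall n,
  (Cmod (k n) <= A * B ^ n * sqrt (INR (fact n)))%R /\
  (Cmod (k (S n)) <= A * B ^ S n * sqrt (INR (fact (S n))))%R).
{ induction n as [|n [IH1 IH2]].
  - simpl; rewrite sqrt_1; split; unfold A; nra.
  - split; [exact IH2|].
    rewrite Hk.
    eapply Rle_trans; [apply Cmod_triangle|].
    rewrite Cmod_opp, !Cmod_mult.
    set (W := sqrt (INR (fact (S (S n))))).
    pose proof (pow_le B n ltac:(lra)) as HBn.
    assert (HABn : (0 <= A * B ^ n)%R) by now apply Rmult_le_pos.
    assert (HABn' : (0 <= A * B ^ S n)%R)
      by (apply Rmult_le_pos; [|apply pow_le]; lra).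
    assert (T1 : (Cmod a * Cmod (k (S n)) <= Cmod a * (A * B ^ S n * W))%R).
    { apply Rmult_le_compat_l; [exact Ha|]; eapply Rle_trans; [exact IH2|].
      apply Rmult_le_compat_l; [exact HABn'|apply Hw1]. }
    assert (T2 : (Cmod (b n) * Cmod (k n) <= D * (A * B ^ n * W))%R).
    { apply Rle_trans with ((D * INR (S n)) * (A * B ^ n * sqrt (INR (fact n))))%R.
      - apply Rmult_le_compat; auto; apply Cmod_ge_0.
      - replace (D * INR (S n) * (A * B ^ n * sqrt (INR (fact n))))%R
          with (D * (A * B ^ n * (INR (S n) * sqrt (INR (fact n)))))%R by ring.
        apply Rmult_le_compat_l; [exact HD|].
        apply Rmult_le_compat_l; [exact HABn|apply Hw2]. }
    eapply Rle_trans; [apply Rplus_le_compat; [exact T1|exact T2]|].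
    replace (Cmod a * (A * B ^ S n * W) + D * (A * B ^ n * W))%R
      with ((A * B ^ n * W) * (Cmod a * B + D))%R by (simpl; ring).
    replace (A * B ^ S (S n) * W)%R with ((A * B ^ n * W) * B ^ 2)%R
      by (simpl; ring).
    apply Rmult_le_compat_l; [|exact HBB].
    apply Rmult_le_pos; [exact HABn|apply sqrt_pos]. }
intros n; apply H.
Qed.

Definition hcoef (K L : nat -> C) (n : nat) : C :=
  2 ^ n / RtoC (INR (fact n)) * K n * L n.

Lemma hcoef_geom_bounded (K L b b' : nat -> C) (a a' : C) (D D' : R) :
  (forall n, K (S (S n)) = a * K (S n) - b n * K n) ->
  (0 <= D)%R -> (forall n, Cmod (b n) <= D * INR (S n))%R ->
  (forall n, L (S (S n)) = a' * L (S n) - b' n * L n) ->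
  (0 <= D')%R -> (forall n, Cmod (b' n) <= D' * INR (S n))%R ->
  exists r : R, (0 < r)%R /\ geom_bounded r (hcoef K L).
Proof.
intros HK HD Hb HL HD' Hb'.
destruct (three_term_growth K b a D HK HD Hb) as [A [B [HB HA]]].
destruct (three_term_growth L b' a' D' HL HD' Hb') as [A' [B' [HB' HA']]].
assert (HBB : (0 < 2 * B * B')%R) by (repeat apply Rmult_lt_0_compat; lra).
exists (/ (2 * B * B'))%R; split; [now apply Rinv_0_lt_compat|].
exists (A * A')%R; intros n; rewrite Rinv_inv.
unfold hcoef, Cdiv; rewrite !Cmod_mult, Cmod_inv_fact, Cmod_pow, Cmod_R.
rewrite (Rabs_right 2) by lra.
pose proof (INR_fact_pos n) as Hf.
assert (E : (A * A' * (2 * B * B') ^ n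
  = 2 ^ n * / INR (fact n) * ((A * B ^ n * sqrt (INR (fact n)))
      * (A' * B' ^ n * sqrt (INR (fact n)))))%R).
{ rewrite !Rpow_mult_distr.
  replace (A * B ^ n * sqrt (INR (fact n)) * (A' * B' ^ n * sqrt (INR (fact n))))%R
    with (A * B ^ n * A' * B' ^ n * (sqrt (INR (fact n)) * sqrt (INR (fact n))))%R
    by ring.
  rewrite sqrt_sqrt by lra; field; lra. }
rewrite E, Rmult_assoc.
apply Rmult_le_compat_l.
- apply Rmult_le_pos; [apply pow_le; lra|now apply Rlt_le, Rinv_0_lt_compat].
- apply Rmult_le_compat; auto; apply Cmod_ge_0.
Qed.

(** The radius obtained from [hcoef_geom_bounded] depends on the shift [m]; an
    identity between finitely many shifted series needs one disc for all of them. *)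
Lemma geom_bounded_common (a : nat -> nat -> C) (N : nat) :
  (forall m, exists r : R, (0 < r)%R /\ geom_bounded r (a m)) ->
  exists r : R, (0 < r)%R /\ forall m, (m <= N)%nat -> geom_bounded r (a m).
Proof.
intros H; induction N as [|N [r [Hr IH]]].
- destruct (H O) as [r [Hr H0]]; exists r; split; [exact Hr|].
  intros m Hm; now replace m with O by lia.
- destruct (H (S N)) as [r' [Hr' H']].
  exists (Rmin r r'); split; [now apply Rmin_glb_lt|].
  assert (H0 : (0 < Rmin r r')%R) by now apply Rmin_glb_lt.
  intros m Hm; destruct (Nat.eq_dec m (S N)) as [->|Hne].
  + apply (geom_bounded_le r'); [split; [exact H0|apply Rmin_r]|exact H'].
  + apply (geom_bounded_le r); [split; [exact H0|apply Rmin_l]|apply IH; lia].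
Qed.

(** * Relations between the bilinear generating series *)

Lemma hcoef_S_factor (n : nat) :
  RtoC (INR (S n)) * (2 ^ S n / RtoC (INR (fact (S n))))
  = 2 * (2 ^ n / RtoC (INR (fact n))).
Proof.
rewrite RtoC_INR_S_fact, Cpow_S; field.
split; [apply RtoC_INR_fact_neq_0|apply RtoC_INR_S_neq_0].
Qed.

(** [L n = eps^(n/2) H_n(x / sqrt eps)]: the Hermite polynomials for [eps = 1] and the
    powers of [x] for [eps = 0]. *)
Definition is_rescaled_hermite (eps x : C) (L : nat -> C) : Prop :=
  L O = 1 /\ L 1%nat = x /\
  forall n, L (S (S n)) = x * L (S n) - eps * RtoC (INR (S n)) / 2 * L n.

(** The recurrence of [L] at the level of generating series.  The term
    [eps n/2 L_(n-1)] produces [eps t s1] because [n 2^n/n! = 2 (2^(n-1)/(n-1)!)]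
    lowers the index of the series by one and so raises that of [K]. *)
Lemma hseries_advance (eps x t : C) (K L : nat -> C) (s0 s1 : C) :
  is_rescaled_hermite eps x L ->
  is_Cseries (fun n => hcoef K L n * t ^ n) s0 ->
  is_Cseries (fun n => hcoef (fun j => K (S j)) L n * t ^ n) s1 ->
  is_Cseries (fun n => hcoef K (fun j => L (S j)) n * t ^ n)
    (x * s0 - eps * t * s1).
Proof.
intros [L0 [L1 HL]] H0 H1.
assert (Hw : is_Cseries (fun n => (x * hcoef K L n
     - hcoef K (fun j => L (S j)) n) * t ^ n) (eps * t * s1)).
{ apply is_Cseries_shift_0.
  - unfold hcoef; rewrite L0, L1; ring.
  - refine (is_Cseries_ext _ _ _ _ _ eq_refl (is_Cseries_scal (eps * t) _ _ H1)).
    intros n; rewrite Cpow_S; unfold hcoef; rewrite HL.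
    pose proof RtoC_2_neq_0 as N2.
    pose proof (RtoC_INR_fact_neq_0 n); pose proof (RtoC_INR_fact_neq_0 (S n)).
    replace (2 ^ n / RtoC (INR (fact n)))
      with (RtoC (INR (S n)) * (2 ^ S n / RtoC (INR (fact (S n)))) / 2)
      by (rewrite hcoef_S_factor; field; auto).
    field; auto. }
refine (is_Cseries_ext _ _ _ _ _ eq_refl
  (is_Cseries_minus _ _ _ _ (is_Cseries_scal x _ _ H0) Hw)).
intros n; simpl; ring.
Qed.

(** The recurrence of a shifted sequence [Phi_(n+m)] splits as
    [(n+m)/2 = n/2 + m/2].  The part [n/2] lowers the index of the series and is
    rewritten by [hseries_advance]; [R] holds the rest, which is [m/2 Phi_(n+m-1)] for
    [m > 0] and the constant [- delta] placed at index 0 for [m = 0]. *)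
Lemma hseries_rec (eps rho x t : C) (K R L : nat -> C) (s0 s1 sR : C) :
  is_rescaled_hermite eps x L ->
  K 1%nat = rho * K O - R O ->
  (forall n, K (S (S n))
     = rho * K (S n) - RtoC (INR (S n)) / 2 * K n - R (S n)) ->
  is_Cseries (fun n => hcoef K L n * t ^ n) s0 ->
  is_Cseries (fun n => hcoef (fun j => K (S j)) L n * t ^ n) s1 ->
  is_Cseries (fun n => hcoef R L n * t ^ n) sR ->
  (1 - eps * t ^ 2) * s1 = (rho - x * t) * s0 - sR.
Proof.
intros HL K1 HK H0 H1 HR.
pose proof (hseries_advance eps x t K L s0 s1 HL H0 H1) as HV.
assert (HU : is_Cseries (fun n => (rho * hcoef K L n - hcoef R L n
     - hcoef (fun j => K (S j)) L n) * t ^ n) (t * (x * s0 - eps * t * s1))).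
{ apply is_Cseries_shift_0.
  - unfold hcoef; rewrite K1; ring.
  - refine (is_Cseries_ext _ _ _ _ _ eq_refl (is_Cseries_scal t _ _ HV)).
    intros n; rewrite Cpow_S; unfold hcoef; rewrite HK.
    pose proof RtoC_2_neq_0 as N2.
    pose proof (RtoC_INR_fact_neq_0 n); pose proof (RtoC_INR_fact_neq_0 (S n)).
    replace (2 ^ n / RtoC (INR (fact n)))
      with (RtoC (INR (S n)) * (2 ^ S n / RtoC (INR (fact (S n)))) / 2)
      by (rewrite hcoef_S_factor; field; auto).
    field; auto. }
assert (E : rho * s0 - sR - s1 = t * (x * s0 - eps * t * s1)).
{ refine (is_Cseries_unique _ _ _ _ HU).
  refine (is_Cseries_ext _ _ _ _ _ eq_refl (is_Cseries_minus _ _ _ _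
    (is_Cseries_minus _ _ _ _ (is_Cseries_scal rho _ _ H0) HR) H1)).
  intros n; simpl; ring. }
replace ((1 - eps * t ^ 2) * s1)
  with (rho * s0 - sR - (rho * s0 - sR - s1) - eps * t ^ 2 * s1) by ring.
rewrite E; simpl; ring.
Qed.

(** Termwise differentiation advances both [K] and [L], and [hseries_advance] removes
    the shift of [L]. *)
Lemma hseries_derive (eps x : C) (K L : nat -> C) (s0 : C -> C) (r : R)
    (t s1 s2 : C) :
  is_rescaled_hermite eps x L ->
  geom_bounded r (hcoef K L) -> (Cmod t < r)%R ->
  (forall u, (Cmod u < r)%R -> is_Cseries (fun n => hcoef K L n * u ^ n) (s0 u)) ->
  is_Cseries (fun n => hcoef (fun j => K (S j)) L n * t ^ n) s1 ->
  is_Cseries (fun n => hcoef (fun j => K (S (S j))) L n * t ^ n) s2 ->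
  is_Cderive s0 t (2 * x * s1 - 2 * eps * t * s2).
Proof.
intros HL Hgb Ht H0 H1 H2.
apply (is_Cderive_Cseries (hcoef K L) s0 _ t r Hgb Ht H0).
refine (is_Cseries_ext _ _ _ _ _ _ (is_Cseries_scal 2 _ _
  (hseries_advance eps x t (fun j => K (S j)) L s1 s2 HL H1 H2))).
- intros n; unfold hcoef.
  replace (RtoC (INR (S n)) * (2 ^ S n / RtoC (INR (fact (S n))) * K (S n) * L (S n)))
    with (RtoC (INR (S n)) * (2 ^ S n / RtoC (INR (fact (S n)))) * K (S n) * L (S n))
    by ring.
  rewrite hcoef_S_factor; ring.
- ring.
Qed.

(** * The closed form of the bilinear generating series *)

Lemma is_Cderive_xi (i : C -> C) (rho x t i' : C) :
  is_Cderive i t i' ->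
  is_Cderive (fun u => (rho - x * u) * i u) t (- x * i t + (rho - x * t) * i').
Proof.
intros Hi; apply (is_Cderive_mult (fun u => rho - x * u)); [|exact Hi].
refine (is_Cderive_ext _ _ _ _ _ (fun w => eq_refl) _
  (is_Cderive_minus _ _ _ _ _ (is_Cderive_const rho t)
    (is_Cderive_scal x _ _ _ (is_Cderive_id t)))).
ring.
Qed.

(** Here [i = (1 - eps t^2)^(-1/2)], so that [(1 - eps t^2) i] stands for [1 / i] and
    the function is the reciprocal of the Mehler kernel [i e^(-xi^2)]. *)
Lemma is_Cderive_integrating_factor (eps rho x t : C) (i : C -> C) :
  i t ^ 2 * (1 - eps * t ^ 2) = 1 ->
  is_Cderive i t (eps * t * i t ^ 3) ->
  is_Cderive
    (fun u => (1 - eps * u ^ 2) * i u * Cexp (((rho - x * u) * i u) ^ 2)) t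
    (- (2 * x * (rho - x * t) * i t ^ 2
        - 2 * eps * t * (rho - x * t) ^ 2 * i t ^ 4 + eps * t * i t ^ 2)
     * ((1 - eps * t ^ 2) * i t * Cexp (((rho - x * t) * i t) ^ 2))).
Proof.
intros Hrel Hi.
pose proof (is_Cderive_xi i rho x t _ Hi) as Hxi.
pose proof (is_Cderive_comp Cexp _ t _ _ (is_Cderive_Cexp _)
  (is_Cderive_sqr _ _ _ Hxi)) as Hexp.
pose proof (is_Cderive_minus _ _ _ _ _ (is_Cderive_const 1 t)
  (is_Cderive_scal eps _ _ _ (is_Cderive_sqr _ _ _ (is_Cderive_id t)))) as Hs.
refine (is_Cderive_ext _ _ _ _ _ (fun w => eq_refl) _
  (is_Cderive_mult _ _ _ _ _ (is_Cderive_mult _ _ _ _ _ Hs Hi) Hexp)).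
cbv beta; set (e := Cexp _); set (p := rho - x * t); set (j := i t) in *.
set (s := 1 - eps * t ^ 2) in *.
transitivity (e * (eps * t * j * (j ^ 2 * s) - 2 * eps * t * j
  + 2 * p * (- x * j + p * (eps * t * j ^ 3)) * (j ^ 2 * s))); [ring|].
transitivity (- e * (j ^ 2 * s) *
  (2 * x * p * j - 2 * eps * t * p ^ 2 * j ^ 3 + eps * t * j)); [|ring].
rewrite Hrel; ring.
Qed.

(** Equivalently, [Phi_m] is [(-1/2)^m] times the [m]-th derivative of a solution of
    [y' = -2 (w y + delta)]; the recurrence is this equation differentiated. *)
Definition is_hermite_tower (delta : C) (Phi : nat -> C -> C) : Prop :=
  (forall w, Phi 1%nat w = w * Phi O w + delta) /\
  (forall m w, Phi (S (S m)) w
     = w * Phi (S m) w - RtoC (INR (S m)) / 2 * Phi m w) /\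
  (forall w, is_Cderive (Phi O) w (- (2) * Phi 1%nat w)).

Lemma Cmod_ray_le (u : R) (t : C) : (0 <= u <= 1)%R ->
  (Cmod (RtoC u * t) <= Cmod t)%R.
Proof.
intros Hu; rewrite Cmod_mult, Cmod_R, Rabs_right by lra.
rewrite <- (Rmult_1_l (Cmod t)) at 2.
apply Rmult_le_compat_r; [apply Cmod_ge_0|lra].
Qed.

(** For [eps = 1] this contains Mehler's formula, for [eps = 0] and [x = 1] it is the
    Taylor expansion of [Phi m] at [rho].  The function [i] is specified by its square,
    its value at 0 and its derivative, so that no branch of the square root enters. *)
Theorem tower_bilinear_series (Phi : nat -> C -> C) (delta eps rho x : C)
    (L : nat -> C) (i : C -> C) (r0 : R) :
  is_hermite_tower delta Phi ->
  is_rescaled_hermite eps x L ->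
  (0 < r0)%R -> i 0 = 1 ->
  (forall t, (Cmod t < r0)%R -> i t ^ 2 * (1 - eps * t ^ 2) = 1) ->
  (forall t, (Cmod t < r0)%R -> is_Cderive i t (eps * t * i t ^ 3)) ->
  forall m, exists r : R, (0 < r)%R /\
    forall t, (Cmod t < r)%R ->
      is_Cseries (fun n => hcoef (fun j => Phi (j + m)%nat rho) L n * t ^ n)
        (i t ^ S m * Phi m ((rho - x * t) * i t)).
Proof.
intros [P1 [PS PD]] HL Hr0 i0 Hrel Hi m.
pose (K := fun k n => Phi (n + k)%nat rho).
assert (Hgeom : forall k, exists r : R,
          (0 < r)%R /\ geom_bounded r (hcoef (K k) L)).
{ intros k.
  apply (hcoef_geom_bounded (K k) L
    (fun n => RtoC (INR (S (n + k))) / 2) (fun n => eps * RtoC (INR (S n)) / 2)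
    rho x (INR k + 1) (Cmod eps)).
  - intros n; unfold K; apply PS.
  - pose proof (pos_INR k); lra.
  - intros n; unfold Cdiv; rewrite Cmod_mult, <- RtoC_inv, !Cmod_R by lra.
    pose proof (pos_INR (S (n + k))).
    rewrite !Rabs_right by lra.
    assert (INR (S (n + k)) <= (INR k + 1) * INR (S n))%R.
    { rewrite <- S_INR, <- mult_INR; apply le_INR; nia. }
    lra.
  - apply HL.
  - apply Cmod_ge_0.
  - intros n; unfold Cdiv; rewrite !Cmod_mult, <- RtoC_inv, !Cmod_R by lra.
    pose proof (pos_INR (S n)); rewrite !Rabs_right by lra.
    pose proof (Rmult_le_pos _ _ (Cmod_ge_0 eps) H); lra. }
destruct (geom_bounded_common (fun k => hcoef (K k) L) (S (S m)) Hgeom)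
  as [r1 [Hr1 HK]].
pose (r := Rmin r0 r1).
assert (Hr : (0 < r)%R) by now apply Rmin_glb_lt.
assert (Hrr0 : (r <= r0)%R) by apply Rmin_l.
exists r; split; [exact Hr|].
assert (HKr : forall k, (k <= S (S m))%nat -> geom_bounded r (hcoef (K k) L)).
{ intros k Hk; apply (geom_bounded_le r1); [|now apply HK].
  split; [exact Hr|apply Rmin_r]. }
assert (HS : forall k t, (k <= S (S m))%nat -> (Cmod t < r)%R ->
          exists s, is_Cseries (fun n => hcoef (K k) L n * t ^ n) s).
{ intros k t Hk Ht; exact (ex_Cseries_geom_bounded r _ t (HKr k Hk) Ht). }
assert (Hshift : forall k t s,
  is_Cseries (fun n => hcoef (K (S k)) L n * t ^ n) s ->
  is_Cseries (fun n => hcoef (fun j => K k (S j)) L n * t ^ n) s).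
{ intros k t s; apply is_Cseries_ext; [|reflexivity].
  intros n; unfold hcoef, K; now rewrite Nat.add_succ_r. }
(* The relations below are solved for the term of highest index: multiplication by
   [i t ^ 2] inverts [1 - eps t ^ 2]. *)
assert (Hrec0 : forall t s0 s1, (Cmod t < r)%R ->
  is_Cseries (fun n => hcoef (K O) L n * t ^ n) s0 ->
  is_Cseries (fun n => hcoef (K 1%nat) L n * t ^ n) s1 ->
  s1 = i t ^ 2 * ((rho - x * t) * s0 + delta)).
{ intros t s0 s1 Ht H0 H1.
  pose (R := fun n : nat => match n with O => - delta | S _ => 0 end : C).
  assert (HR : is_Cseries (fun n => hcoef R L n * t ^ n) (- delta)).
  { assert (HZ : is_Cseries (fun n => hcoef R L (S n) * t ^ S n) 0).
    { refine (is_Cseries_ext _ _ _ _ _ eq_refl is_Cseries_0).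
      intros n; unfold hcoef, R; ring. }
    refine (is_Cseries_ext _ _ _ _ (fun n => eq_refl) _
      (is_Cseries_shift (fun n => hcoef R L n * t ^ n) 0 HZ)).
    unfold hcoef, R; rewrite (proj1 HL); simpl; field; apply C1_nz. }
  pose proof (hseries_rec eps rho x t (K O) R L s0 s1 (- delta) HL) as HH.
  assert (E : (1 - eps * t ^ 2) * s1 = (rho - x * t) * s0 - - delta).
  { apply HH; auto.
    - unfold K, R; simpl; rewrite P1; ring.
    - intros n; unfold K, R; rewrite !Nat.add_0_r, PS; ring. }
  transitivity (i t ^ 2 * ((1 - eps * t ^ 2) * s1)).
  - rewrite Cmult_assoc, Hrel by lra; ring.
  - rewrite E; ring. }
assert (HrecS : forall k t s0 s1 s2, (Cmod t < r)%R ->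
  is_Cseries (fun n => hcoef (K k) L n * t ^ n) s0 ->
  is_Cseries (fun n => hcoef (K (S k)) L n * t ^ n) s1 ->
  is_Cseries (fun n => hcoef (K (S (S k))) L n * t ^ n) s2 ->
  s2 = i t ^ 2 * ((rho - x * t) * s1 - RtoC (INR (S k)) / 2 * s0)).
{ intros k t s0 s1 s2 Ht H0 H1 H2.
  assert (E : (1 - eps * t ^ 2) * s2
              = (rho - x * t) * s1 - RtoC (INR (S k)) / 2 * s0).
  { apply (hseries_rec eps rho x t (K (S k))
      (fun n => RtoC (INR (S k)) / 2 * K k n) L s1 s2); auto.
    - unfold K; simpl; apply PS.
    - intros n; unfold K.
      replace (S n + S k)%nat with (S (S (n + k))) by lia.
      replace (S (S n) + S k)%nat with (S (S (S (n + k)))) by lia.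
      replace (n + S k)%nat with (S (n + k)) by lia.
      replace (S n + k)%nat with (S (n + k)) by lia.
      rewrite PS.
      replace (INR (S (S (n + k)))) with (INR (S n) + INR (S k))%R
        by (rewrite <- plus_INR; f_equal; lia).
      rewrite RtoC_plus; field; intros E; apply RtoC_inj in E; lra.
    - refine (is_Cseries_ext _ _ _ _ _ eq_refl
        (is_Cseries_scal (RtoC (INR (S k)) / 2) _ _ H0)).
      intros n; unfold hcoef; ring. }
  transitivity (i t ^ 2 * ((1 - eps * t ^ 2) * s2)).
  - rewrite Cmult_assoc, Hrel by lra; ring.
  - rewrite E; ring. }
(* The case [m = 0]: the difference of the two sides times the reciprocal of the
   Mehler kernel has derivative zero and vanishes at 0. *)
assert (Base : forall t, (Cmod t < r)%R ->
  is_Cseries (fun n => hcoef (K O) L n * t ^ n)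
    (i t * Phi O ((rho - x * t) * i t))).
{ assert (Hex : forall t, exists s, (Cmod t < r)%R ->
     is_Cseries (fun n => hcoef (K O) L n * t ^ n) s).
  { (* Outside the disc the value is arbitrary; 0 is a default. *)
    intros t; destruct (Rlt_dec (Cmod t) r) as [Ht|Ht].
    - destruct (HS O t ltac:(lia) Ht) as [s Hs]; now exists s.
    - exists 0; intros Ht'; contradiction. }
  pose (s0 := fun t => proj1_sig (constructive_indefinite_description _ (Hex t))).
  assert (Hs0 : forall t, (Cmod t < r)%R ->
    is_Cseries (fun n => hcoef (K O) L n * t ^ n) (s0 t)).
  { intros t; exact (proj2_sig (constructive_indefinite_description _ (Hex t))). }
  pose (F := fun t => i t * Phi O ((rho - x * t) * i t)).
  pose (psi := fun u => (1 - eps * u ^ 2) * i u * Cexp (((rho - x * u) * i u) ^ 2)).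
  assert (HD : forall t, (Cmod t < r)%R ->
    is_Cderive (fun u => (s0 u - F u) * psi u) t 0).
  { intros t Ht.
    destruct (HS 1%nat t ltac:(lia) Ht) as [s1 Hs1].
    destruct (HS 2%nat t ltac:(lia) Ht) as [s2 Hs2].
    pose proof (hseries_derive eps x (K O) L s0 r t s1 s2 HL
      (HKr O ltac:(lia)) Ht Hs0 (Hshift _ _ _ Hs1)) as Hs0'.
    assert (Hs2' : is_Cseries
      (fun n => hcoef (fun j => K O (S (S j))) L n * t ^ n) s2).
    { refine (is_Cseries_ext _ _ _ _ _ eq_refl Hs2).
      intros n; unfold hcoef, K; now rewrite !Nat.add_succ_r. }
    specialize (Hs0' Hs2').
    pose proof (Hi t ltac:(lra)) as Hit.
    pose proof (is_Cderive_xi i rho x t _ Hit) as Hxi.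
    pose proof (is_Cderive_mult _ _ _ _ _ Hit
      (is_Cderive_comp (Phi O) _ t _ _ (PD _) Hxi)) as HF.
    pose proof (is_Cderive_integrating_factor eps rho x t i (Hrel t ltac:(lra)) Hit)
      as Hpsi.
    refine (is_Cderive_ext _ _ _ _ _ (fun w => eq_refl) _
      (is_Cderive_mult _ _ _ _ _ (is_Cderive_minus _ _ _ _ _ Hs0' HF) Hpsi)).
    (* Substituting for [s1] and [s2] makes every term proportional to [s0 t - F t];
       the terms in [delta] cancel. *)
    cbv beta; fold (psi t).
    rewrite (HrecS O t _ _ _ Ht (Hs0 t Ht) Hs1 Hs2),
      (Hrec0 t _ _ Ht (Hs0 t Ht) Hs1), P1.
    simpl INR; field; intros E; apply RtoC_inj in E; lra. }
  intros t Ht.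
  assert (E : (s0 t - F t) * psi t = (s0 0 - F 0) * psi 0).
  { apply (Cderive_0_const (fun u => (s0 u - F u) * psi u)).
    intros u Hu; apply HD.
    eapply Rle_lt_trans; [now apply Cmod_ray_le|exact Ht]. }
  assert (E0 : s0 0 = F 0).
  { rewrite (is_Cseries_at_0 _ _ (Hs0 0 ltac:(rewrite Cmod_0; exact Hr))).
    unfold F, hcoef, K; rewrite i0, (proj1 HL); simpl.
    replace ((rho - x * 0) * 1) with rho by ring.
    field; apply C1_nz. }
  rewrite E0 in E; replace ((F 0 - F 0) * psi 0) with (0 : C) in E by ring.
  assert (Hpsi : psi t <> 0).
  { unfold psi; apply Cmult_neq_0; [|apply Cexp_neq_0].
    intros Z; pose proof (Hrel t ltac:(lra)) as HZ; apply C1_nz.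
    rewrite <- HZ.
    replace (i t ^ 2 * (1 - eps * t ^ 2)) with (i t * ((1 - eps * t ^ 2) * i t))
      by (simpl; ring).
    rewrite Z; ring. }
  assert (ES : s0 t = F t).
  { replace (s0 t) with ((s0 t - F t) * psi t / psi t + F t) by (now field).
    rewrite E; now field. }
  change (is_Cseries (fun n => hcoef (K O) L n * t ^ n) (F t)).
  rewrite <- ES; now apply Hs0. }
intros t Ht.
(* Two consecutive indices, since the recurrence has order two. *)
assert (Step : forall k, (k <= m)%nat ->
  is_Cseries (fun n => hcoef (K k) L n * t ^ n)
    (i t ^ S k * Phi k ((rho - x * t) * i t)) /\
  is_Cseries (fun n => hcoef (K (S k)) L n * t ^ n)
    (i t ^ S (S k) * Phi (S k) ((rho - x * t) * i t))).
{ induction k as [|k IH]; intros Hk.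
  - assert (H0 : is_Cseries (fun n => hcoef (K O) L n * t ^ n)
      (i t ^ 1 * Phi O ((rho - x * t) * i t))).
    { rewrite Cpow_1_r; now apply Base. }
    split; [exact H0|].
    destruct (HS 1%nat t ltac:(lia) Ht) as [s1 Hs1].
    refine (is_Cseries_ext _ _ _ _ (fun n => eq_refl) _ Hs1).
    rewrite (Hrec0 t _ _ Ht H0 Hs1), P1; ring.
  - destruct (IH ltac:(lia)) as [H0 H1]; split; [exact H1|].
    destruct (HS (S (S k)) t ltac:(lia) Ht) as [s2 Hs2].
    refine (is_Cseries_ext _ _ _ _ (fun n => eq_refl) _ Hs2).
    rewrite (HrecS k t _ _ _ Ht H0 H1 Hs2), PS, !Cpow_S; ring. }
exact (proj1 (Step m (Nat.le_refl m))).
Qed.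

(** * The function (1 - t^2)^(-1/2) *)

Lemma Cexp_INR_mult (n : nat) (z : C) : Cexp (RtoC (INR n) * z) = Cexp z ^ n.
Proof.
induction n as [|n IH].
- simpl; rewrite Cmult_0_l; apply Cexp_0.
- rewrite S_INR, RtoC_plus, Cpow_S, <- IH, <- Cexp_plus; f_equal; ring.
Qed.

Lemma Re_1_minus_sqr_pos (t : C) : (Cmod t < 1)%R -> (0 < Re (1 - t ^ 2)%C)%R.
Proof.
intros Ht; change (0 < 1 - Re (t ^ 2)%C)%R.
pose proof (re_le_Cmod (t ^ 2)) as H; rewrite Cmod_pow in H.
pose proof (Rle_abs (Re (t ^ 2)%C)); pose proof (Cmod_ge_0 t).
assert (Cmod t ^ 2 < 1)%R by nra.
lra.
Qed.

Lemma Clog_1 : Clog 1 = 0.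
Proof.
unfold Clog, Carg; rewrite Cmod_1, ln_1; simpl.
unfold Rdiv; rewrite Rmult_0_l, atan_0, Rmult_0_r; reflexivity.
Qed.

Lemma Cpower_inv_sqrt_sqr (z : C) : (0 < Re z)%R -> Cpower z (- (1 / 2)) ^ 2 * z = 1.
Proof.
intros Hz; rewrite <- (Cexp_Clog z Hz) at 2; unfold Cpower.
rewrite <- Cexp_INR_mult, <- Cexp_plus.
transitivity (Cexp 0); [f_equal|apply Cexp_0].
replace (INR 2) with 2%R by (simpl; lra); field; apply RtoC_2_neq_0.
Qed.

Lemma Cdiv_Csqrt (p z : C) : p / Csqrt z = p * Cpower z (- (1 / 2)).
Proof.
assert (E : Csqrt z * Cpower z (- (1 / 2)) = 1).
{ unfold Csqrt, Cpower; rewrite <- Cexp_plus.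
  transitivity (Cexp 0); [f_equal; ring|apply Cexp_0]. }
assert (N : Csqrt z <> 0) by apply Cexp_neq_0.
replace (p / Csqrt z) with (p * (Csqrt z * Cpower z (- (1 / 2))) / Csqrt z)
  by (rewrite E; now field).
now field.
Qed.

Lemma Cpower_inv_sqrt_pow (z : C) (m : nat) :
  Cpower z (- (RtoC (INR m + 1) / 2)) = Cpower z (- (1 / 2)) ^ S m.
Proof.
unfold Cpower; rewrite <- Cexp_INR_mult, S_INR; f_equal.
field; apply RtoC_2_neq_0.
Qed.

(** The factor 1 is the parameter [eps] of [tower_bilinear_series]. *)
Lemma is_Cderive_inv_sqrt (t : C) : (Cmod t < 1)%R ->
  is_Cderive (fun u => Cpower (1 - u ^ 2) (- (1 / 2))) t
    (1 * t * Cpower (1 - t ^ 2) (- (1 / 2)) ^ 3).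
Proof.
intros Ht; pose proof (Re_1_minus_sqr_pos t Ht) as Hz.
assert (Hz0 : 1 - t ^ 2 <> 0).
{ intros E; rewrite E in Hz; simpl in Hz; lra. }
pose proof (Cpower_inv_sqrt_sqr _ Hz) as Hrel.
pose proof (is_Cderive_minus _ _ _ _ _ (is_Cderive_const 1 t)
  (is_Cderive_sqr _ _ _ (is_Cderive_id t))) as Hs.
pose proof (is_Cderive_scal (- (1 / 2)) _ _ _
  (is_Cderive_comp Clog _ t _ _ (is_Cderive_Clog _ Hz) Hs)) as Hl.
refine (is_Cderive_ext _ _ _ _ _ (fun u => eq_refl) _
  (is_Cderive_comp Cexp _ t _ _ (is_Cderive_Cexp _) Hl)).
cbv beta; change (Cexp (- (1 / 2) * Clog (1 - t ^ 2)))
  with (Cpower (1 - t ^ 2) (- (1 / 2))).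
set (j := Cpower _ _) in *; set (z := 1 - t ^ 2) in *.
transitivity (t * j * (j ^ 2 * z / z)); [rewrite Hrel|]; field;
  auto using RtoC_2_neq_0.
Qed.

(** * The two Hermite towers and the four identities *)

Lemma has_power_series_Cseries (f : C -> C) (a b : nat -> C) (r : R) :
  (0 < r)%R ->
  (forall t, (Cmod t < r)%R -> is_Cseries (fun n => b n * t ^ n) (f t)) ->
  (forall n, a n = b n) ->
  has_power_series f a.
Proof.
intros Hr H E; exists r; split; [exact Hr|]; intros t Ht.
refine (is_Cseries_ext _ _ _ _ _ eq_refl (H t Ht)).
intros n; rewrite <- E; apply Cmult_comm.
Qed.

Lemma hermite_S_S (n : nat) (x : C) :
  hermite (S (S n)) x = x * hermite (S n) x - RtoC (INR (S n)) / 2 * hermite n x.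
Proof. rewrite hermite_rec; ring. Qed.

(** The constant [e^(rho^2)] normalises the family to equal [H_m] at [w = rho]. *)
Definition hermite_gauss (rho : C) (m : nat) (w : C) : C :=
  Cexp (rho ^ 2) * Cexp (- w ^ 2) * hermite m w.

(** The function of the second kind of the Hermite recurrence, normalised so that its
    transcendental part vanishes at [w = rho]. *)
Definition hermite_second (rho : C) (m : nat) (w : C) : C :=
  hermite_assoc 1 (Z.of_nat m - 1) w
  + RtoC (sqrt PI) * (erfi rho - erfi w) * Cexp (- w ^ 2) * hermite m w.

Lemma is_Cderive_gauss (w : C) :
  is_Cderive (fun u => Cexp (- u ^ 2)) w (- (2) * w * Cexp (- w ^ 2)).
Proof.
refine (is_Cderive_ext _ _ _ _ _ (fun u => eq_refl) _
  (is_Cderive_comp Cexp (fun u => - u ^ 2) w _ (- (2) * w) (is_Cderive_Cexp _) _)).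
- reflexivity.
- refine (is_Cderive_ext _ _ _ _ _ _ _
    (is_Cderive_scal (- (1)) _ _ _ (is_Cderive_sqr _ _ _ (is_Cderive_id w))));
    [intros u|]; ring.
Qed.

Lemma hermite_gauss_derive (rho w : C) :
  is_Cderive (hermite_gauss rho 0) w (- (2) * hermite_gauss rho 1 w).
Proof.
refine (is_Cderive_ext _ _ _ _ _ _ _
  (is_Cderive_scal (Cexp (rho ^ 2)) _ _ _ (is_Cderive_gauss w)));
  [intros u|]; unfold hermite_gauss; simpl hermite; ring.
Qed.

Lemma hermite_gauss_diag (rho : C) (m : nat) :
  hermite_gauss rho m rho = hermite m rho.
Proof. unfold hermite_gauss; rewrite Cexp_opp_r; ring. Qed.

Lemma hermite_gauss_S_S (rho : C) (m : nat) (w : C) :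
  hermite_gauss rho (S (S m)) w
  = w * hermite_gauss rho (S m) w
    - RtoC (INR (S m)) / 2 * hermite_gauss rho m w.
Proof. unfold hermite_gauss; rewrite hermite_S_S; ring. Qed.

Lemma RtoC_sqrt_PI_neq_0 : RtoC (sqrt PI) <> 0.
Proof.
intros E; apply RtoC_inj in E.
pose proof (sqrt_lt_R0 _ PI_RGT_0); lra.
Qed.

(** As [H_(-1)(w,1) = 0], the family starts with the purely transcendental term.  Its
    derivative contains [- 2 e^(w^2) e^(-w^2) = - 2], which is [- 2 H_0(w,1)]. *)
Lemma hermite_second_derive (rho w : C) :
  is_Cderive (hermite_second rho 0) w (- (2) * hermite_second rho 1 w).
Proof.
pose proof RtoC_sqrt_PI_neq_0 as HPI.
refine (is_Cderive_ext _ _ _ _ _ _ _ (is_Cderive_mult _ _ _ _ _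
  (is_Cderive_scal (RtoC (sqrt PI)) _ _ _
    (is_Cderive_minus _ _ _ _ _ (is_Cderive_const (erfi rho) w)
      (is_Cderive_erfi w)))
  (is_Cderive_gauss w))).
- intros u; unfold hermite_second; simpl; ring.
- unfold hermite_second; simpl hermite; simpl Z.sub; simpl hermite_assoc.
  transitivity (- (2) * (Cexp (w ^ 2) * Cexp (- w ^ 2))
    + RtoC (sqrt PI) * (erfi rho - erfi w) * (- (2) * w * Cexp (- w ^ 2))).
  + now field.
  + rewrite Cexp_opp_r; ring.
Qed.

Lemma hermite_second_diag (rho : C) (m : nat) :
  hermite_second rho m rho = hermite_assoc 1 (Z.of_nat m - 1) rho.
Proof. unfold hermite_second; ring. Qed.

Lemma hermite_second_S_S (rho : C) (m : nat) (w : C) :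
  hermite_second rho (S (S m)) w
  = w * hermite_second rho (S m) w
    - RtoC (INR (S m)) / 2 * hermite_second rho m w.
Proof.
unfold hermite_second; rewrite hermite_S_S.
pose proof (hermite_assoc_rec 1 (Z.of_nat m) w ltac:(lia)) as H.
replace (Z.of_nat (S (S m)) - 1)%Z with (Z.of_nat m + 1)%Z by lia.
replace (Z.of_nat (S m) - 1)%Z with (Z.of_nat m) by lia.
rewrite <- INR_IZR_INZ in H.
replace (hermite_assoc 1 (Z.of_nat m + 1) w)
  with (w * hermite_assoc 1 (Z.of_nat m) w
        - (RtoC (INR m) + 1) / 2 * hermite_assoc 1 (Z.of_nat m - 1) w)
  by (rewrite H; ring).
rewrite S_INR, RtoC_plus; ring.
Qed.

Lemma hermite_gauss_tower (rho : C) : is_hermite_tower 0 (hermite_gauss rho).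
Proof.
split; [|split; [apply hermite_gauss_S_S|apply hermite_gauss_derive]].
intros w; unfold hermite_gauss; simpl hermite; ring.
Qed.

Lemma hermite_second_tower (rho : C) : is_hermite_tower 1 (hermite_second rho).
Proof.
split; [|split; [apply hermite_second_S_S|apply hermite_second_derive]].
intros w; unfold hermite_second; simpl; ring.
Qed.

Lemma hermite_rescaled (x : C) : is_rescaled_hermite 1 x (fun n => hermite n x).
Proof.
split; [reflexivity|]; split; [reflexivity|]; intros n.
rewrite hermite_S_S; field; apply RtoC_2_neq_0.
Qed.

Lemma one_rescaled : is_rescaled_hermite 0 1 (fun _ => 1).
Proof.
split; [reflexivity|]; split; [reflexivity|]; intros n.
field; apply RtoC_2_neq_0.
Qed.

Lemma tower_mehler_series (Phi : nat -> C -> C) (delta rho x : C) :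
  is_hermite_tower delta Phi ->
  forall m, has_power_series
    (fun t => Cpower (1 - t ^ 2) (- (RtoC (INR m + 1) / 2))
              * Phi m ((rho - x * t) / Csqrt (1 - t ^ 2)))
    (fun n => 2 ^ n / RtoC (INR (fact n)) * Phi (n + m)%nat rho * hermite n x).
Proof.
intros HPhi m.
destruct (tower_bilinear_series Phi delta 1 rho x (fun n => hermite n x)
  (fun t => Cpower (1 - t ^ 2) (- (1 / 2))) 1 HPhi (hermite_rescaled x)
  Rlt_0_1) with (m := m) as [r [Hr H]].
- replace (1 - 0 ^ 2) with (1 : C) by ring.
  unfold Cpower; rewrite Clog_1, Cmult_0_r; apply Cexp_0.
- intros t Ht; rewrite Cmult_1_l; now apply Cpower_inv_sqrt_sqr, Re_1_minus_sqr_pos.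
- exact is_Cderive_inv_sqrt.
- refine (has_power_series_Cseries _ _
    (hcoef (fun j => Phi (j + m)%nat rho) (fun n => hermite n x)) r Hr _ _).
  + intros t Ht; rewrite Cpower_inv_sqrt_pow, Cdiv_Csqrt; now apply H.
  + reflexivity.
Qed.

Lemma tower_taylor_series (Phi : nat -> C -> C) (delta rho : C) :
  is_hermite_tower delta Phi ->
  forall m, has_power_series
    (fun t => Phi m (rho - t))
    (fun n => 2 ^ n / RtoC (INR (fact n)) * Phi (n + m)%nat rho).
Proof.
intros HPhi m.
destruct (tower_bilinear_series Phi delta 0 rho 1 (fun _ => 1)
  (fun t => 1) 1 HPhi one_rescaled Rlt_0_1 eq_refl) with (m := m)
  as [r [Hr H]].
- intros t _; ring.
- intros t _; replace (0 * t * 1 ^ 3) with (0 : C) by ring; apply is_Cderive_const.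
- refine (has_power_series_Cseries _ _
    (hcoef (fun j => Phi (j + m)%nat rho) (fun _ => 1)) r Hr _ _).
  + intros t Ht; replace (Phi m (rho - t))
      with (1 ^ S m * Phi m ((rho - 1 * t) * 1)); [now apply H|].
    replace ((rho - 1 * t) * 1) with (rho - t) by ring.
    rewrite Cpow_1_l; ring.
  + intros n; unfold hcoef; ring.
Qed.

Lemma has_power_series_ext (f g : C -> C) (a b : nat -> C) (r : R) :
  (0 < r)%R -> (forall t, (Cmod t < r)%R -> f t = g t) -> (forall n, a n = b n) ->
  has_power_series f a -> has_power_series g b.
Proof.
intros Hr Hfg Hab [r' [Hr' H]].
exists (Rmin r r'); split; [now apply Rmin_glb_lt|]; intros t Ht.
apply Rmin_Rgt in Ht as [Ht Ht'].
refine (is_Cseries_ext _ _ _ _ _ (Hfg t Ht) (H t Ht')).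
intros n; now rewrite Hab.
Qed.

Theorem theorem4p2 : forall (m : nat) (rho x : C),
  has_power_series
    (fun t : C =>
       Cpower (1 - t ^ 2) (- (RtoC (INR m + 1) / 2))
       * Cexp (rho ^ 2 - (rho - x * t) ^ 2 / (1 - t ^ 2))
       * hermite m ((rho - x * t) / Csqrt (1 - t ^ 2)))
    (fun n : nat =>
       2 ^ n / RtoC (INR (fact n)) * hermite (n + m) rho * hermite n x)
  /\
  has_power_series
    (fun t : C =>
       hermite m (rho - t) * Cexp (2 * rho * t - t ^ 2))
    (fun n : nat =>
       2 ^ n / RtoC (INR (fact n)) * hermite (n + m) rho)
  /\
  has_power_series
    (fun t : C =>
       Cpower (1 - t ^ 2) (- (RtoC (INR m + 1) / 2))
       * (hermite_assoc 1 (Z.of_nat m - 1)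
            ((rho - x * t) / Csqrt (1 - t ^ 2))
          + RtoC (sqrt PI)
            * (erfi rho - erfi ((rho - x * t) / Csqrt (1 - t ^ 2)))
            * Cexp (- ((rho - x * t) ^ 2 / (1 - t ^ 2)))
            * hermite m ((rho - x * t) / Csqrt (1 - t ^ 2))))
    (fun n : nat =>
       2 ^ n / RtoC (INR (fact n))
       * hermite_assoc 1 (Z.of_nat n + Z.of_nat m - 1) rho * hermite n x)
  /\
  has_power_series
    (fun t : C =>
       hermite_assoc 1 (Z.of_nat m - 1) (rho - t)
       + RtoC (sqrt PI) * (erfi rho - erfi (rho - t))
         * Cexp (- (rho - t) ^ 2) * hermite m (rho - t))
    (fun n : nat =>
       2 ^ n / RtoC (INR (fact n))
       * hermite_assoc 1 (Z.of_nat n + Z.of_nat m - 1) rho).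
Proof.
intros m rho x.
assert (Hsq : forall t, (Cmod t < 1)%R ->
  ((rho - x * t) / Csqrt (1 - t ^ 2)) ^ 2 = (rho - x * t) ^ 2 / (1 - t ^ 2)).
{ intros t Ht; pose proof (Re_1_minus_sqr_pos t Ht) as Hz.
  assert (Hz0 : 1 - t ^ 2 <> 0) by (intros E; rewrite E in Hz; simpl in Hz; lra).
  rewrite Cdiv_Csqrt, Cpow_mult_l.
  replace (Cpower (1 - t ^ 2) (- (1 / 2)) ^ 2)
    with (Cpower (1 - t ^ 2) (- (1 / 2)) ^ 2 * (1 - t ^ 2) / (1 - t ^ 2))
    by (now field).
  rewrite Cpower_inv_sqrt_sqr by exact Hz; now field. }
split; [|split; [|split]].
- refine (has_power_series_ext _ _ _ _ 1 Rlt_0_1 _ _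
    (tower_mehler_series (hermite_gauss rho) 0 rho x (hermite_gauss_tower rho) m)).
  + intros t Ht; unfold hermite_gauss; rewrite (Hsq t Ht), <- Cexp_plus.
    unfold Cminus; ring.
  + intros n; now rewrite hermite_gauss_diag.
- refine (has_power_series_ext _ _ _ _ 1 Rlt_0_1 _ _
    (tower_taylor_series (hermite_gauss rho) 0 rho (hermite_gauss_tower rho) m)).
  + intros t Ht; unfold hermite_gauss; rewrite <- Cexp_plus.
    replace (rho ^ 2 + - (rho - t) ^ 2) with (2 * rho * t - t ^ 2) by ring; ring.
  + intros n; now rewrite hermite_gauss_diag.
- refine (has_power_series_ext _ _ _ _ 1 Rlt_0_1 _ _
    (tower_mehler_series (hermite_second rho) 1 rho x (hermite_second_tower rho) m)).
  + intros t Ht; unfold hermite_second; now rewrite (Hsq t Ht).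
  + intros n; now rewrite hermite_second_diag, Nat2Z.inj_add.
- refine (has_power_series_ext _ _ _ _ 1 Rlt_0_1 _ _
    (tower_taylor_series (hermite_second rho) 1 rho (hermite_second_tower rho) m)).
  + reflexivity.
  + intros n; now rewrite hermite_second_diag, Nat2Z.inj_add.
Qed.
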